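(* There is an algorithm which, given an AT-free graph $G$ (finite, simple, connected, with no isolated vertices), computes in time linear in the size of $G$ a paired dominating set $D$ of $G$ satisfying $|D| \le 2\cdot \gamma_{pr}(G)$.
   Context: For a graph $G=(V,E)$, a set $D\subseteq V$ is dominating if every vertex of $V\setminus D$ has a neighbour in $D$. For a graph with no isolated vertices, a paired dominating set (PD-set) is a dominating set $D$ such that the induced subgraph $G[D]$ has a perfect matching; $\gamma_{pr}(G)$ denotes the minimum cardinality of a PD-set of $G$. Three pairwise non-adjacent vertices form an asteroidal triple if for any two of them there is a path between them avoiding the closed neighbourhood of the third; a graph is AT-free if it contains no asteroidal triple. *)

(* Defs.v *)
From mathcomp Require Import all_boot.

Set Implicit Arguments.
Unset Strict Implicit.
Unset Printing Implicit Defensive.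

Section Graphs.
Variables (T : finType) (e : rel T).
Implicit Types (D : {set T}) (M : {set {set T}}) (u v w : T).

Definition simple_graph : Prop := symmetric e /\ irreflexive e.

Definition connected_graph : Prop := 0 < #|T| /\ forall u v, connect e u v.

Definition no_isolated_vertex : Prop := forall u, exists v, e u v.

Definition edges : {set {set T}} :=
  [set [set p.1; p.2] | p : T * T & e p.1 p.2].

Definition closed_nbhd v : {set T} := [set u | (u == v) || e v u].

Definition dominating D : bool :=
  [forall v, (v \notin D) ==> [exists u in D, e v u]].

(* [partition M D] forces both endpoints of every edge of [M] to lie in [D],
   so that [M] consists of edges of the induced subgraph on [D]. *)
Definition perfect_matching_on D M : bool := (M \subset edges) && partition M D.

Definition pd_set D : bool :=
  dominating D && [exists M : {set {set T}}, perfect_matching_on D M].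

(* The default value [#|T|] bounds every term, so it does not affect the minimum
   as soon as a PD-set exists, which holds in graphs without isolated vertices. *)
Definition gamma_pr : nat := \big[minn/#|T|]_(D : {set T} | pd_set D) #|D|.

Definition avoiding_path u v w : Prop :=
  exists p : seq T,
    [/\ path e u p, last u p = v & all [predC closed_nbhd w] (u :: p)].

Definition asteroidal_triple u v w : Prop :=
  [/\ uniq [:: u; v; w],
      [/\ ~~ e u v, ~~ e v w & ~~ e u w] &
      [/\ avoiding_path u v w, avoiding_path v w u & avoiding_path u w v]].

Definition at_free : Prop := forall u v w, ~ asteroidal_triple u v w.

End Graphs.

(* A word RAM, presented as a while language over finitely many registers and
   finitely many arrays (those named in the program text); all of them are
   addressed by numerals, the arrays are random access, and each elementary
   operation has unit cost. *)
Inductive binop := Add | Sub | Lt | Eq.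

Inductive expr :=
  | Const of nat
  | Reg of nat
  | Read of nat & expr
  | Bin of binop & expr & expr.

Inductive cmd :=
  | Skip
  | Assign of nat & expr
  | Write of nat & expr & expr
  | Seq of cmd & cmd
  | If of expr & cmd & cmd
  | While of expr & cmd.

Record state := State { reg : nat -> nat; arr : nat -> nat -> nat }.

Definition upd (A : Type) (f : nat -> A) (i : nat) (a : A) : nat -> A :=
  fun j => if j == i then a else f j.

Definition set_reg (s : state) (x v : nat) : state :=
  State (upd (reg s) x v) (arr s).

Definition set_arr (s : state) (a i v : nat) : state :=
  State (reg s) (upd (arr s) a (upd (arr s a) i v)).

Definition binop_eval (o : binop) (x y : nat) : nat :=
  match o with
  | Add => x + y
  | Sub => x - y
  | Lt => x < y
  | Eq => x == y
  end.

(* Machine words hold the naturals below [W]; computing a value that does not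
   fit in a word is an error, and a program with an error has no execution. *)
Definition fit (W v : nat) : option nat := if v < W then Some v else None.

Fixpoint eval (W : nat) (s : state) (x : expr) : option nat :=
  match x with
  | Const k => fit W k
  | Reg r => fit W (reg s r)
  | Read a i => obind (fun j => fit W (arr s a j)) (eval W s i)
  | Bin o y z =>
      obind (fun v => obind (fun w => fit W (binop_eval o v w)) (eval W s z))
            (eval W s y)
  end.

Fixpoint cost (x : expr) : nat :=
  match x with
  | Const _ | Reg _ => 1
  | Read _ i => (cost i).+1
  | Bin _ y z => (cost y + cost z).+1
  end.

(* [exec W p s t s']: on words below [W], the program [p] started in [s] halts
   in [s'] after exactly [t] steps. Guards are true when nonzero. *)
Inductive exec (W : nat) : cmd -> state -> nat -> state -> Prop :=
  | exec_skip s : exec W Skip s 1 s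
  | exec_assign s r x v :
      eval W s x = Some v ->
      exec W (Assign r x) s (cost x).+1 (set_reg s r v)
  | exec_write s a x y i v :
      eval W s x = Some i -> eval W s y = Some v ->
      exec W (Write a x y) s (cost x + cost y).+1 (set_arr s a i v)
  | exec_seq p q s s1 s2 t1 t2 :
      exec W p s t1 s1 -> exec W q s1 t2 s2 ->
      exec W (Seq p q) s (t1 + t2) s2
  | exec_if x p q s s1 b t :
      eval W s x = Some b -> exec W (if b != 0 then p else q) s t s1 ->
      exec W (If x p q) s (cost x + t).+1 s1
  | exec_while_false x p s :
      eval W s x = Some 0 ->
      exec W (While x p) s (cost x).+1 s
  | exec_while_true x p s s1 s2 b t1 t2 :
      eval W s x = Some b.+1 -> exec W p s t1 s1 ->
      exec W (While x p) s1 t2 s2 ->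
      exec W (While x p) s (cost x + t1 + t2).+1 s2.

Section Encoding.
Variable n : nat.

(* The neighbours of each vertex, listed once each in an arbitrary order. *)
Definition adjacency_lists (e : rel 'I_n) (adj : 'I_n -> seq 'I_n) : Prop :=
  forall v, uniq (adj v) /\ adj v =i e v.

Definition offsets (adj : 'I_n -> seq 'I_n) : seq nat :=
  [seq \sum_(v < n | v < k) size (adj v) | k <- iota 0 n.+1].

Definition neighbours (adj : 'I_n -> seq 'I_n) : seq nat :=
  [seq val u | u <- flatten [seq adj v | v <- enum 'I_n]].

(* Register 0 holds [n], array 0 the [n.+1] offsets, and array 1 the concatenated
   adjacency lists, that of vertex [v] occupying the positions from the [v]-th
   offset (included) to the next one (excluded). All the other registers and
   cells are 0. *)
Definition input (adj : 'I_n -> seq 'I_n) : state :=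
  State (nth 0 [:: n])
        (fun a => nth 0 (nth [::] [:: offsets adj; neighbours adj] a)).

(* The computed set, read off array 2 as a characteristic vector. *)
Definition output (s : state) : {set 'I_n} := [set v : 'I_n | arr s 2 v != 0].

End Encoding.

(* Main.v *)
Require Import Defs.
From mathcomp Require Import all_boot.
From mathcomp Require Import zify.

Set Implicit Arguments.
Unset Strict Implicit.
Unset Printing Implicit Defensive.

(* Let [x] be any vertex, [L] the distance from [x] and [k] its maximum. Among
   the vertices at distance [k] let [y] have the fewest neighbours in level
   [k - 1] and, among those, the fewest neighbours in level [k] that have more
   neighbours in level [k - 1] than [y]. Let [M] be the distance from [y] and
   [m] its maximum. If [k >= 3], let [z] be a vertex at distance [m] from [y]
   with the fewest neighbours in level [m - 1]; then every shortest path from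
   [z] to [y] that enters the neighbourhood of [y] as close to [x] as possible
   is dominating. Indeed two vertices in the component of [x] in [G - N[y]]
   cannot each be joined to [y] avoiding the neighbourhood of the other, as they
   would form an asteroidal triple with [y]; this handles that component, and
   any other component lies in level [k] and consists of vertices with the same
   neighbours as [y] in level [k - 1], for which the two minimality conditions
   on [y] produce an asteroidal triple containing [x].
   If [k <= 2 < m], start again from [x := y]. If [m <= 2], four vertices of the
   form [z], [q], [y], [a] suffice, where [q] is a common neighbour of [y] and
   [z] and [a] a common neighbour of [x] and [y].
   A matched pair dominates vertices from at most four consecutive levels of
   [M], so the path has at most [2 * gamma_pr] vertices, with room for one more
   if their number is odd: then add a neighbour of [y], or delete [y] if it has
   no neighbour off the path. All of this takes a constant number of
   breadth-first searches and scans of the adjacency lists. *)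

(** * Levels and avoiding paths *)

(* Boolean hypotheses other than comparisons make [lia] explore exponentially
   many cases. *)
Ltac nlia := try assumption; repeat match goal with
  | H : is_true ?b |- _ =>
    lazymatch b with
    | leq _ _ => fail | andb (leq _ _) _ => fail | eq_op _ _ => fail
    | _ => clear H
    end
  end; lia.

Section Avoidance.
Variables (T : finType) (e : rel T).
Hypotheses (e_sym : symmetric e) (e_irr : irreflexive e).
Implicit Types u v w x y : T.

Local Notation avoids u v w := (avoiding_path e u v w).
Local Notation N w := (closed_nbhd e w).

Lemma mem_nbhd u v : (u \in N v) = (u == v) || e v u.
Proof. by rewrite inE. Qed.

Lemma nbhd_sym u v : (u \in N v) = (v \in N u).
Proof. by rewrite !mem_nbhd eq_sym e_sym. Qed.

Lemma avoids_refl u w : u \notin N w -> avoids u u w.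
Proof. by move=> uw; exists [::]; rewrite /= uw. Qed.

Lemma avoids_step u b v w : u \notin N w -> e u b -> avoids b v w -> avoids u v w.
Proof.
move=> uw ub [p [bp lp ap]]; exists (b :: p); split => //=; first by rewrite ub.
by rewrite uw.
Qed.

Lemma avoids_trans u v v' w : avoids u v w -> avoids v v' w -> avoids u v' w.
Proof.
case=> p [up lp ap] [q [vq lq aq]]; exists (p ++ q); split.
- by rewrite cat_path up lp.
- by rewrite last_cat lp.
- by rewrite -cat_cons all_cat ap; case/andP: aq.
Qed.

Lemma avoids_sym u v w : avoids u v w -> avoids v u w.
Proof.
case=> p [up lp ap]; exists (rev (belast u p)); split.
- by rewrite -lp rev_path; rewrite (eq_path (e' := e)) // => a b; apply: e_sym.
- by case: p {up ap} lp => [|a p] /= lp; rewrite ?rev_cons ?last_rcons.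
- by rewrite -lp -rev_rcons -lastI all_rev.
Qed.

Lemma avoids_start u v w : avoids u v w -> u \notin N w.
Proof. by case=> p [_ _ /andP[]]. Qed.

(** The ends of an avoiding path lie outside the closed neighbourhood that it avoids, so three such
    paths already force distinctness and non-adjacency. *)
Lemma no_asteroidal_triple u v w : at_free e ->
  avoids u v w -> avoids v w u -> avoids u w v -> False.
Proof.
move=> atf uvw vwu uwv; apply: (atf u v w).
have := avoids_start uvw; have := avoids_start vwu.
have := avoids_start (avoids_sym uvw).
rewrite !mem_nbhd !negb_or => /andP[vw evw] /andP[vu euv] /andP[uw euw].
split; last by split.
- by rewrite /= !inE !negb_or eq_sym vu uw vw.
- by split; rewrite // e_sym.
Qed.

(* The rooted-distance function is characterized by these four local
   properties. *)
Definition is_level (src : T) (lev : T -> nat) : Prop :=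
  [/\ lev src = 0, forall v, lev v = 0 -> v = src,
      forall u v, e u v -> lev u <= (lev v).+1 &
      forall v, 0 < lev v -> exists2 u, e v u & (lev u).+1 = lev v].

Section Level.
Variables (src : T) (lev : T -> nat).
Hypothesis levP : is_level src lev.

Lemma level_src : lev src = 0. Proof. by case: levP. Qed.

Lemma level_adj u v : e u v -> lev u <= (lev v).+1 /\ lev v <= (lev u).+1.
Proof. by case: levP => _ _ H _ uv; split; apply: H; rewrite // e_sym. Qed.

Lemma level_parent v : 0 < lev v -> exists2 u, e v u & (lev u).+1 = lev v.
Proof. by case: levP => _ _ _; apply. Qed.

Lemma nbhd_level u v : u \in N v -> lev u <= (lev v).+1 /\ lev v <= (lev u).+1.
Proof.
by rewrite mem_nbhd => /orP[/eqP->//|/level_adj []].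
Qed.

Lemma level1 v : (lev v == 1) = e src v.
Proof.
apply/eqP/idP => [v1|sv].
  have [|u vu u0] := @level_parent v; first by rewrite v1.
  by case: levP => _ H _ _; rewrite e_sym -(H u) //; nlia.
have [_] := level_adj sv; rewrite level_src.
case E: (lev v) => [|[|//]] // _.
by case: levP => _ H _ _; move: sv; rewrite (H _ E) e_irr.
Qed.

Lemma level_gt1 v : (1 < lev v) = (v \notin N src).
Proof.
rewrite mem_nbhd -level1; case: levP => l0 H _ _.
have := H v; case: (eqVneq v src) => [->|/eqP ne]; first by rewrite l0.
by case: (lev v) => [/(_ erefl)//|[|n]].
Qed.

(** A shortest path to the source stays on levels at most [lev u], while the closed neighbourhood of
    [w] lies on levels at least [lev w - 1]. *)
Lemma avoids_below u w : (lev u).+1 < lev w -> avoids u src w.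
Proof.
elim: {u}(lev u) {-2}u (erefl (lev u)) => [|l IH] u lu lw.
  case: levP => _ H _ _; rewrite (H u) //; apply: avoids_refl.
  by apply/negP => /nbhd_level; rewrite level_src; nlia.
have [|b ub lb] := @level_parent u; first by nlia.
apply: avoids_step ub _; first by apply/negP => /nbhd_level; nlia.
by apply: IH; nlia.
Qed.

Lemma avoids_lower u w : u \notin N w -> lev u < lev w -> avoids u src w.
Proof.
move=> uw lw; case: (posnP (lev u)) => [u0|/level_parent[b ub lb]].
  by case: levP => _ H _ _; rewrite -(H u u0); apply: avoids_refl.
by apply: avoids_step ub _ => //; apply: avoids_below; nlia.
Qed.

(** Used mostly for [u] on the level of [w], where a private lower neighbour [b] of [u] opens the
    way down. *)
Lemma avoids_via u b w : u \notin N w -> e u b -> b \notin N w ->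
  lev b < lev w -> avoids u src w.
Proof. by move=> uw ub bw lb; apply: avoids_step ub _ => //; apply: avoids_lower. Qed.

End Level.
End Avoidance.

(** * Paired dominating sets *)

Section PairedDomination.
Variables (T : finType) (e : rel T).
Hypotheses (e_sym : symmetric e) (e_irr : irreflexive e).
Implicit Types (u v w : T) (D S : {set T}).

Local Notation N w := (closed_nbhd e w).

Lemma edgesP (B : {set T}) :
  reflect (exists u v, e u v /\ B = [set u; v]) (B \in edges e).
Proof.
apply: (iffP imsetP) => [[[u v] /=]|[u [v [uv ->]]]].
  by rewrite inE => uv ->; exists u, v.
by exists (u, v); rewrite ?inE.
Qed.

Lemma card_edge (B : {set T}) : B \in edges e -> #|B| = 2.
Proof.
case/edgesP => u [v [uv ->]]; rewrite cards2.
by case: eqVneq uv => // ->; rewrite e_irr.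
Qed.

(** Each edge, as an unordered pair, comes from at most two ordered pairs. *)
Lemma card_arcs : #|[set p : T * T | e p.1 p.2]| <= 2 * #|edges e|.
Proof.
set A := [set _ | _]; pose f (p : T * T) := [set p.1; p.2].
rewrite -sum1_card (partition_big f (mem (edges e))) /=; last first.
  by case=> u v; rewrite inE /= => uv; apply/edgesP; exists u, v.
rewrite mulnC -sum_nat_const; apply: leq_sum => B /edgesP[u [v [uv ->]]].
rewrite sum1_card; apply: leq_trans (_ : #|[set (u, v); (v, u)]| <= 2); last first.
  by rewrite cards2; case: eqP.
apply: subset_leq_card; apply/subsetP => -[a b]; rewrite !inE /= => /andP[ab /eqP E].
have ne : a != b by apply: contraTneq ab => ->; rewrite inE /= e_irr.
have /orP[/eqP aE|/eqP aE] : (a == u) || (a == v) by rewrite -in_set2 -E /f set21.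
  have : b \in [set u; v] by rewrite -E /f set22.
  by rewrite in_set2 -aE (eq_sym b a) (negPf ne) /= => /eqP->; rewrite aE eqxx.
have : b \in [set u; v] by rewrite -E /f set22.
by rewrite in_set2 -aE (eq_sym b a) (negPf ne) orbF => /eqP->; rewrite aE eqxx orbT.
Qed.

(** Consecutive vertices are matched in pairs; the induction removes two vertices at a time, hence
    it runs on a bound for the size. *)
Lemma path_matching (s : seq T) : uniq s -> ~~ odd (size s) -> sorted e s ->
  exists M, perfect_matching_on e [set u in s] M.
Proof.
elim: {s}(size s) {-2}s (leqnn (size s)) => [|n IH] [|a [|b s]] //= sn.
- exists set0; rewrite /perfect_matching_on sub0set /partition /cover.
  rewrite big_set0 inE andbT /=; apply/andP; split; last by apply/trivIsetP => ?; rewrite inE.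
  by apply/eqP/setP => u; rewrite !inE.
- exists set0; rewrite /perfect_matching_on sub0set /partition /cover.
  rewrite big_set0 inE andbT /=; apply/andP; split; last by apply/trivIsetP => ?; rewrite inE.
  by apply/eqP/setP => u; rewrite !inE.
rewrite negbK inE negb_or => /and3P[/andP[ab a_s] b_s s_uniq] s_even /andP[eab bs].
have [||||M /andP[Me Mp]] := IH s => //; first by nlia.
  exact: path_sorted bs.
exists ([set a; b] |: M); apply/andP; split.
  apply/subsetP => B; rewrite !inE => /predU1P[->|/(subsetP Me)//].
  by apply/edgesP; exists a, b.
have -> : [set u in [:: a, b & s]] = [set a; b] :|: [set u in s].
  by apply/setP => u; rewrite !inE orbA.
case/and3P: Mp => /eqP cM tM M0; apply/and3P; split.
- by rewrite /cover bigcup_setU big_set1 -/(cover M) cM.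
- apply/trivIsetP => B C; rewrite !inE.
  have disj B' : B' \in M -> [disjoint [set a; b] & B'].
    move=> B'M; rewrite -setI_eq0; apply/eqP/setP => u; rewrite !inE.
    case: (boolP (u \in B')) => uB; rewrite ?andbF // andbT.
    have : u \in cover M by apply/bigcupP; exists B'.
    rewrite cM inE => us; apply/negbTE; rewrite negb_or.
    by apply/andP; split; apply: contraTneq us => ->.
  move=> /predU1P[->|BM] /predU1P[->|CM] BC; rewrite ?eqxx // in BC *.
  + exact: disj.
  + by rewrite disjoint_sym; apply: disj.
  + by move/trivIsetP: tM; apply.
- rewrite !inE negb_or M0 andbT; apply/eqP => /setP/(_ a).
  by rewrite !inE eqxx.
Qed.

Lemma path_pd_set (s : seq T) : uniq s -> ~~ odd (size s) -> sorted e s ->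
  (forall v, exists2 u, u \in s & v \in N u) -> pd_set e [set u in s].
Proof.
move=> s_uniq s_even s_path dom; apply/andP; split; last first.
  have [M HM] := path_matching s_uniq s_even s_path.
  by apply/existsP; exists M.
apply/forallP => v; apply/implyP; rewrite inE => vs.
have [u us] := dom v; rewrite mem_nbhd => /orP[/eqP E|uv].
  by rewrite -E (negPf vs) in us.
by apply/existsP; exists u; rewrite inE us e_sym.
Qed.

(* A matched pair only dominates vertices from four consecutive levels. *)
Lemma pd_set_levels (src : T) (lev : T -> nat) S h : is_level e src lev ->
  pd_set e S -> (forall i, i < h -> exists w, lev w = i) ->
  h + odd h <= 2 * #|S|.
Proof.
move=> levP /andP[domS /existsP[M /andP[Me Mp]]] lev_onto.
have M2 B : B \in M -> #|B| = 2 by move/(subsetP Me)/card_edge.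
rewrite (card_uniform_partition M2 Mp).
(* [#|S|] is [#|M| * 2], and [#|M| * 4] is even, so rounding [h] up to an even number is free. *)
suff : h <= #|M| * 4.
  have := odd_double_half h; case: (odd h); last by nlia.
  by rewrite -muln2; nlia.
pose X := \max_w lev w; have leX u : lev u <= X by apply: (leq_bigmax (F := lev)).
(* The least level in [B] minus one, the minimum being written as a maximum of complements in [X].
   The pair [B] reaches only the four levels from [low B] on. *)
pose low (B : {set T}) := (X - \max_(w in B) (X - lev w)).-1.
suff sub : {subset iota 0 h <= flatten [seq iota (low B) 4 | B <- enum M]}.
  have := uniq_leq_size (iota_uniq 0 h) sub; rewrite size_iota size_flatten.
  move/leq_trans; apply; rewrite /shape -map_comp (eq_map (g := fun=> 4)).
    by rewrite sumnE big_map big_const_seq count_predT -cardE iter_addn_0 mulnC.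
  by move=> B /=.
move=> i; rewrite mem_iota /= add0n => ih.
have [w wi] := lev_onto i ih.
have [d dS wd] : exists2 d, d \in S & w \in N d.
  case: (boolP (w \in S)) => wS; first by exists w; rewrite ?mem_nbhd ?eqxx.
  move/forallP/(_ w)/implyP/(_ wS): domS => /existsP[d /andP[dS wd]].
  by exists d; rewrite // mem_nbhd e_sym wd orbT.
case/and3P: Mp => /eqP cM _ _.
have /bigcupP[B BM dB] : d \in cover M by rewrite cM.
apply/flattenP; exists (iota (low B) 4).
  by apply: map_f; rewrite mem_enum.
have := subsetP Me _ BM => /edgesP[a [b [ab BE]]].
have -> : low B = (minn (lev a) (lev b)).-1.
  rewrite /low BE big_setU1 ?big_set1 /=; first by have := leX a; have := leX b; nlia.
  by rewrite inE; apply: contraTneq ab => ->; rewrite e_irr.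
have := leX a; have := leX b; have := nbhd_level e_sym levP wd; have := level_adj e_sym levP ab.
rewrite mem_iota; move: dB; rewrite BE !inE => /orP[]/eqP->; nlia.
Qed.

Lemma gamma_pr_lower D : (forall S, pd_set e S -> #|D| <= 2 * #|S|) ->
  #|D| <= 2 * gamma_pr e.
Proof.
move=> H; rewrite /gamma_pr.
(* The base case is the default value [#|T|] of the minimum, which is at least [#|D|]. *)
elim/big_ind: _ => [|a b Ha Hb|S /H//]; first exact: leq_trans (max_card _) (leq_pmull _ _).
by rewrite /minn; case: ifP.
Qed.

End PairedDomination.

(** * A dominating path *)

Section TwoSweeps.
Variables (T : finType) (e : rel T).
Hypotheses (e_sym : symmetric e) (e_irr : irreflexive e) (atf : at_free e).
Implicit Types u v w : T.

Local Notation avoids u v w := (avoiding_path e u v w).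
Local Notation N w := (closed_nbhd e w).

Definition nbrs_at (lev : T -> nat) (l : nat) (v : T) : {set T} :=
  [set u | e v u && (lev u == l)].

Variables (x y : T) (L M : T -> nat) (k m : nat).
Hypotheses (LP : is_level e x L) (MP : is_level e y M).
Hypotheses (L_le : forall v, L v <= k.+1) (M_le : forall v, M v <= m).

Definition lower_nbrs := nbrs_at L k.
(** By [lower_min] the threshold is the least count on level [k.+1], so these are the neighbours on
    that level whose count is not minimal. *)
Definition heavy_nbrs v : {set T} :=
  [set u | [&& e v u, L u == k.+1 & #|lower_nbrs y| < #|lower_nbrs u|]].

(* The eccentricity of [x], called [k] above, is [k.+1] from here on. *)
Hypothesis Ly : L y = k.+1.
Hypothesis lower_min : forall v, L v = k.+1 -> #|lower_nbrs y| <= #|lower_nbrs v|.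
Hypothesis heavy_min : forall v, L v = k.+1 ->
  #|lower_nbrs v| = #|lower_nbrs y| -> #|heavy_nbrs y| <= #|heavy_nbrs v|.

(** Membership in the component of [x] once the closed neighbourhood of [y] is removed. *)
Definition joined v := avoids v x y.

Lemma mem_lower u v : (u \in lower_nbrs v) = e v u && (L u == k).
Proof. by rewrite inE. Qed.

Lemma lower_y_M1 a : a \in lower_nbrs y -> M a = 1.
Proof.
by rewrite mem_lower => /andP[ya _]; apply/eqP; rewrite (level1 e_sym e_irr MP).
Qed.

Lemma joined_lt v : v \notin N y -> L v <= k -> joined v.
Proof. by move=> vy Lv; apply: (avoids_lower e_sym LP); rewrite // Ly. Qed.

Lemma joined_lower v b : v \notin N y -> b \in lower_nbrs v ->
  b \notin lower_nbrs y -> joined v.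
Proof.
rewrite !mem_lower => vy /andP[vb /eqP Lb]; rewrite Lb eqxx andbT => yb.
apply: (avoids_via e_sym LP vy vb); last by rewrite Lb Ly.
by rewrite mem_nbhd negb_or yb andbT; apply/eqP => bE; move: Lb; rewrite bE Ly; nlia.
Qed.

(** Below level [k.+1] the way down to [x] is free, and a lower neighbour not shared with [y] also
    leads to [x]. So all lower neighbours are shared, and [y] having the fewest forces equality. *)
Lemma twin_lower v : v \notin N y -> ~ joined v ->
  L v = k.+1 /\ lower_nbrs v = lower_nbrs y.
Proof.
move=> vy nj; have Lv : L v = k.+1.
  have := L_le v; case: (leqP (L v) k) => [/(joined_lt vy)//|]; nlia.
split=> //; apply/eqP; rewrite eqEcard lower_min // andbT.
apply/subsetP => b bv; apply/negPn/negP => yb.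
exact: nj (joined_lower vy bv yb).
Qed.

Lemma joined_step u v : joined u -> e v u -> v \notin N y -> joined v.
Proof. by move=> ju vu vy; apply: avoids_step vu ju. Qed.

(** Two joined vertices are linked through [x] outside the closed neighbourhood of [y], so the two
    further paths would complete an asteroidal triple [u], [v], [y]. *)
Lemma joined_unrelated u v : joined u -> joined v ->
  avoids u y v -> avoids v y u -> False.
Proof.
move=> ju jv uyv vyu; apply: (no_asteroidal_triple e_sym atf _ vyu uyv).
exact: avoids_trans ju (avoids_sym e_sym jv).
Qed.

(** If [v] is on the last level of [L], its parent there has [M]-level at least 2, hence is not a
    neighbour of [y] and leads to [x]. *)
Lemma joined_M3 v : 2 < M v -> joined v.
Proof.
move=> Mv; have vy : v \notin N y by rewrite -(level_gt1 e_sym e_irr MP); nlia.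
have [b vb Mb] := level_parent MP (ltnW (ltnW Mv)).
have by_ : b \notin N y by rewrite -(level_gt1 e_sym e_irr MP); nlia.
have := L_le v; rewrite leq_eqVlt => /orP[/eqP Lv|]; last exact: joined_lt.
have [c vc Lc] : exists2 u, e v u & (L u).+1 = L v.
  by apply: (level_parent LP); rewrite Lv.
apply: (@joined_lower _ c) => //; first by rewrite mem_lower vc; apply/eqP; nlia.
by apply/negP => /lower_y_M1 Mc; have := level_adj e_sym MP vc; nlia.
Qed.

(** If [v] were missed, [q] would be a neighbour of [z] only; as [z] has no more neighbours on that
    level than [v], some [b] there is a neighbour of [v] only. Then [q] and [b] lead [z] and [v]
    down to [y], each avoiding the other. *)
Lemma top_dominated z q v : joined z -> joined v -> M v = M z ->
  #|nbrs_at M (M q) z| <= #|nbrs_at M (M q) v| -> e z q -> (M q).+1 = M z ->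
  (v \in N z) || (v \in N q).
Proof.
move=> jz jv Mv card zq Mq; apply/negPn/negP; rewrite negb_or => /andP[vz vq].
have [b] : exists2 b, b \in nbrs_at M (M q) v & b \notin nbrs_at M (M q) z.
  apply/subsetPn; apply/negP => sub.
  have /eqP E : nbrs_at M (M q) v == nbrs_at M (M q) z by rewrite eqEcard sub.
  have : q \in nbrs_at M (M q) v by rewrite E inE zq eqxx.
  by rewrite inE => /andP[vq' _]; move: vq; rewrite nbhd_sym // mem_nbhd vq' orbT.
rewrite !inE => /andP[vb /eqP Mb]; rewrite Mb eqxx andbT => zb.
apply: (joined_unrelated jv jz).
  apply: (avoids_via e_sym MP vz vb); last by nlia.
  by rewrite mem_nbhd negb_or zb andbT; apply/eqP => bz; move: Mb; rewrite bz; nlia.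
by apply: (avoids_via e_sym MP _ zq); rewrite ?(nbhd_sym e_sym _ v) //; nlia.
Qed.

(** * Domination by a path descending from [p h] to [y] *)

Section Path.
Variables (h : nat) (p : nat -> T).
Hypothesis Mp : forall i, i <= h -> M (p i) = i.
Hypothesis p_adj : forall i, i < h -> e (p i.+1) (p i).
Hypothesis p_low : forall i u, i < h -> e (p i.+1) u -> M u = i -> L (p i) <= L u.

Lemma path_start : p 0 = y.
Proof. by case: MP => _ H _ _; apply: H; rewrite Mp. Qed.

(** Otherwise [v] descends to [y] from below the path vertex of the next level, and that vertex
    descends along the path past [v], each avoiding the closed neighbourhood of the other. *)
Lemma middle_dominated v : joined v -> 2 <= M v < h ->
  exists2 i, i <= h & v \in N (p i).
Proof.
move=> jv /andP[]; move E: (M v) => [|[|i]] // _ ih.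
case: (boolP (v \in N (p i.+3))) => [|v3]; first by exists i.+3.
case: (boolP (v \in N (p i.+2))) => [|v2]; first by exists i.+2; nlia.
case: (boolP (v \in N (p i.+1))) => [|v1]; first by exists i.+1; nlia.
exfalso; have jp : joined (p i.+3) by apply: joined_M3; rewrite Mp.
apply: (joined_unrelated jv jp).
  by apply: (avoids_lower e_sym MP v3); rewrite Mp // E.
apply: (@avoids_step _ _ _ (p i.+2)); rewrite ?(nbhd_sym e_sym _ v) ?p_adj //.
by apply: (avoids_via e_sym MP _ (p_adj _)); rewrite ?(nbhd_sym e_sym _ v) ?Mp ?E //; nlia.
Qed.

(** Such a [v] has the same lower neighbours as [y]. Were it missed by [p 1], the choice of [p 1]
    and both minimality conditions on [y] would give an asteroidal triple of [x], [v] and one of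
    [p 1], [p 2], or make [p 1] a neighbour of [v] after all. *)
Lemma twin_dominated v : 2 <= k -> 3 <= h -> ~ joined v -> v \notin N y ->
  v \in N (p 1).
Proof.
move=> k2 h3 njv vy; apply/negPn/negP => v1.
have [Lv lv] := twin_lower vy njv.
have e1 : e (p 1) y by rewrite -path_start p_adj //; nlia.
have e21 : e (p 2) (p 1) by rewrite p_adj //; nlia.
have p2y : p 2 \notin N y by rewrite -(level_gt1 e_sym e_irr MP) Mp //; nlia.
have j2 : joined (p 2).
  by apply: (@joined_step (p 3)); rewrite // 1?e_sym ?p_adj //; apply: joined_M3; rewrite Mp.
have [a ya La] : exists2 u, e y u & (L u).+1 = L y.
  by apply: (level_parent LP); rewrite Ly.
have Ma : M a = 1 by apply: lower_y_M1; rewrite mem_lower ya; apply/eqP; nlia.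
have nbr_v b : L b = k -> e v b = e y b.
  by move=> Lb; move/setP/(_ b): lv; rewrite !mem_lower Lb eqxx !andbT.
have va : e v a by rewrite nbr_v //; nlia.
have nx u : k <= L u -> u \notin N x.
  by move=> Lu; rewrite -(level_gt1 e_sym e_irr LP); nlia.
(* Private lower neighbours [b] and [c] lead [u] and [v] to [x]; together with a path from [v] to
   [u] away from [x] they give the forbidden triple. *)
have to_x u : u \notin N v -> v \notin N u -> L u = k.+1 ->
  (exists2 b, e u b & L b = k /\ ~~ e y b) ->
  (exists2 c, e v c & L c = k /\ ~~ e u c) -> avoids v u x -> False.
- move=> uv vu Lu [b ub [Lb yb]] [c vc [Lc uc]] vux.
  have ux : avoids u x v.
    apply: (avoids_via e_sym LP uv ub); last by nlia.
    by rewrite mem_nbhd negb_or nbr_v // yb andbT; apply/eqP => bv; move: Lb; rewrite bv; nlia.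
  have vx : avoids v x u.
    apply: (avoids_via e_sym LP vu vc); last by nlia.
    by rewrite mem_nbhd negb_or uc andbT; apply/eqP => cu; move: Lc; rewrite cu; nlia.
  exact: (no_asteroidal_triple e_sym atf vux ux vx).
have p1nv : p 1 \notin N v by rewrite nbhd_sym.
have np1a b : e y b -> L b = k -> p 1 <> b.
  move=> yb Lb p1b; move: p1nv; rewrite mem_nbhd negb_or p1b nbr_v // yb.
  by rewrite andbF.
(* [v] sees every lower neighbour of [y] but not [p 1], so [p 1] is on the last level. *)
have L1 : L (p 1) = k.+1.
  have [_] := level_adj e_sym LP e1; have := L_le (p 1); rewrite Ly.
  have := np1a (p 1) _ _; rewrite e_sym e1 => /(_ isT) H ? ?.
  by case: (eqVneq (L (p 1)) k) => [/H//|]; nlia.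
(* Otherwise the path would have entered the neighbourhood of [y] through [b], which is closer to
   [x] than [p 1]. *)
have p2a b : e y b -> L b = k -> ~~ e (p 2) b.
  move=> yb Lb; apply/negP => p2b.
  have Mb : M b = 1 by apply: lower_y_M1; rewrite mem_lower yb Lb eqxx.
  by have := p_low (ltac:(nlia) : 1 < h) p2b Mb; nlia.
(* Equal lower neighbourhoods of [p 1] and [y]: the triple is [x], [v], [p 2], and the path [v],
   [a], [p 1], [p 2] keeps to levels at least [k], away from [x]. *)
case: (boolP (lower_nbrs (p 1) \subset lower_nbrs y)) => [sub1|/subsetPn[b]].
  have /eqP E1 : lower_nbrs (p 1) == lower_nbrs y by rewrite eqEcard sub1 lower_min.
  have a1 : e (p 1) a.
    by move/setP/(_ a): E1; rewrite !mem_lower ya -eqSS La Ly eqxx !andbT.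
  have L2 : L (p 2) = k.+1.
    have [_] := level_adj e_sym LP e21; have := L_le (p 2); rewrite L1.
    case: (eqVneq (L (p 2)) k) => [E|]; last by nlia.
    move/setP/(_ (p 2)): E1; rewrite !mem_lower E eqxx !andbT e_sym e21.
    by move: p2y; rewrite mem_nbhd negb_or => /andP[_ /negPf->].
  have v2 : v \notin N (p 2).
    rewrite mem_nbhd negb_or; apply/andP; split; apply/negP.
      by move=> /eqP vE; apply: njv; rewrite vE.
    by move=> H; apply: njv; apply: (joined_step j2); rewrite // e_sym.
  have v2' : p 2 \notin N v by rewrite nbhd_sym.
  apply: (to_x (p 2)) => //.
  - have [b eb Lb] : exists2 u, e (p 2) u & (L u).+1 = L (p 2).
      by apply: (level_parent LP); rewrite L2.
    exists b => //; split; first by nlia.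
    by apply/negP => yb; move/negP: (p2a b yb ltac:(nlia)); apply.
  - by exists a; rewrite // p2a //; nlia.
  apply: (@avoids_step _ _ _ a) => //; first by apply: nx; nlia.
  apply: (@avoids_step _ _ _ (p 1)); [by apply: nx; nlia|by rewrite e_sym|].
  apply: (@avoids_step _ _ _ (p 2)); [by apply: nx; nlia|by rewrite e_sym|].
  by apply: avoids_refl; apply: nx; nlia.
rewrite !mem_lower => /andP[b1 /eqP Lb]; rewrite Lb eqxx andbT => yb.
(* If [p 1] has all lower neighbours of [y] and more, it is heavy. Heavy neighbours of [v] are
   neighbours of [y], since otherwise [v] would be joined through them, so the second minimality
   makes both sets equal and [p 1] a neighbour of [v]. *)
case: (boolP (lower_nbrs y \subset lower_nbrs (p 1))) => [sub1|/subsetPn[c]].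
  have card1 : #|lower_nbrs y| < #|lower_nbrs (p 1)|.
    apply: proper_card; apply/properP; split=> //; exists b.
      by rewrite mem_lower b1 Lb eqxx.
    by rewrite mem_lower (negPf yb).
  have sub : heavy_nbrs v \subset heavy_nbrs y.
    apply/subsetP => w; rewrite !inE => /and3P[vw -> cw]; rewrite cw !andbT.
    apply/negPn/negP => yw; apply: njv.
    have wy : w \notin N y.
      rewrite mem_nbhd negb_or yw andbT; apply/eqP => wE.
      by move: cw; rewrite wE ltnn.
    have /subsetPn[d dw dy] : ~~ (lower_nbrs w \subset lower_nbrs y).
      by apply/negP => /subset_leq_card; rewrite leqNgt cw.
    exact: joined_step (joined_lower wy dw dy) vw vy.
  have /eqP E : heavy_nbrs v == heavy_nbrs y by rewrite eqEcard sub heavy_min // lv.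
  have : p 1 \in heavy_nbrs v by rewrite E inE e_sym e1 L1 eqxx.
  by rewrite inE => /and3P[v1' _ _]; move: v1; rewrite nbhd_sym // mem_nbhd v1' orbT.
(* Incomparable lower neighbourhoods: the triple is [x], [v], [p 1], linked by [v], [a], [y],
   [p 1]. *)
rewrite !mem_lower => /andP[yc /eqP Lc]; rewrite Lc eqxx andbT => c1.
apply: (to_x (p 1)) => //.
- by exists b.
- by exists c; rewrite // nbr_v.
apply: (@avoids_step _ _ _ a) => //; first by apply: nx; nlia.
apply: (@avoids_step _ _ _ y); [by apply: nx; nlia|by rewrite e_sym|].
apply: (@avoids_step _ _ _ (p 1)); [by apply: nx; nlia|by rewrite e_sym|].
by apply: avoids_refl; apply: nx; nlia.
Qed.

Lemma path_dominates_long v : 2 <= k -> m = h ->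
  (forall w, M w = h -> #|nbrs_at M h.-1 (p h)| <= #|nbrs_at M h.-1 w|) ->
  exists2 i, i <= h & v \in N (p i).
Proof.
move=> k2 mh zmin.
have h3 : 3 <= h.
  rewrite -mh; apply: leq_trans (M_le x).
  have : k.+1 <= M x; last by nlia.
  (* Along a shortest path from [y], [L] drops from [k.+1] by at most one per step; at [x] this
     bounds [M x] from below. *)
  suff H l w : M w = l -> k.+1 <= L w + l by have := H _ x erefl; rewrite (level_src LP).
  elim: l w => [|l IH] w Mw.
    by case: MP => _ H _ _; rewrite (H w Mw) Ly; nlia.
  have [|b wb Mb] := @level_parent _ _ _ _ MP w; first by rewrite Mw.
  have := IH b ltac:(nlia); have := level_adj e_sym LP wb; nlia.
case: (boolP (v \in N (p 1))) => [|v1]; first by exists 1; nlia.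
case: (boolP (v \in N y)) => [|vy]; first by exists 0; rewrite ?path_start.
case: (boolP [exists i : 'I_h.+1, v \in N (p i)]) => [/existsP[i]|nd].
  by exists i => //; have := ltn_ord i; nlia.
have nd' i : i <= h -> v \notin N (p i).
  move=> ih; apply/negP => vi; move/negP: nd; apply; apply/existsP.
  by exists (Ordinal (ih : i < h.+1)).
exfalso; apply/negP: v1; apply/negPn; apply: twin_dominated => // jv.
have M2 : 1 < M v by rewrite (level_gt1 e_sym e_irr MP).
(* The last level is covered by the minimal choice of [p h], the levels from 2 below it by the path
   itself. *)
case: (ltngtP (M v) h) => [vh|vh|vh]; last 1 first.
- have hE : h.-1.+1 = h by nlia.
  have Mq : M (p h.-1) = h.-1 by rewrite Mp //; nlia.
  have := @top_dominated (p h) (p h.-1) v; rewrite !Mp //; last by nlia.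
  rewrite (negPf (nd' h _)) // (negPf (nd' h.-1 _)) //; last by nlia.
  move=> H; suff: false by []; apply: H; rewrite ?hE //.
  + by apply: joined_M3; rewrite Mp.
  + exact: zmin.
  + by rewrite -{1}hE; apply: p_adj; nlia.
- have [|i ih vi] := @middle_dominated v jv; first by nlia.
  by move/negP: (nd' i ih); apply.
- by have := M_le v; nlia.
Qed.

End Path.

(** A vertex missed by [y] and [a] is joined: otherwise it would share the lower neighbours of [y],
    including [a]. The last hypothesis makes [z] joined as well, since a vertex with the lower
    neighbours of [y] has at least that many neighbours on level 1 of [M]. Then [top_dominated]
    applies to [z] and [q]. *)
Lemma short_dominated z q a v : m <= 2 -> e y a -> L a = k -> e z q -> M z = 2 ->
  M q = 1 ->
  (forall w, M w = 2 -> #|nbrs_at M 1 z| <= #|nbrs_at M 1 w|) ->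
  (z = x \/ #|nbrs_at M 1 z| < #|lower_nbrs y|) ->
  [|| v \in N z, v \in N q, v \in N y | v \in N a].
Proof.
move=> m2 ya La zq Mz Mq zmin zx; apply/negPn/negP.
rewrite !negb_or => /and4P[vz vq vy va].
have Mv : M v = 2.
  by have := M_le v; move: vy; rewrite -(level_gt1 e_sym e_irr MP); nlia.
have zy : z \notin N y by rewrite -(level_gt1 e_sym e_irr MP) Mz.
have A_M1 : lower_nbrs y \subset [set u | M u == 1].
  by apply/subsetP => u /lower_y_M1 Mu; rewrite inE Mu.
have twin_sub w : ~ joined w -> w \notin N y -> lower_nbrs y \subset nbrs_at M 1 w.
  move=> nj wy; have [_ E] := twin_lower wy nj.
  apply/subsetP => u uy; rewrite inE (lower_y_M1 uy) eqxx andbT.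
  by move: uy; rewrite -E mem_lower => /andP[].
suff jz : joined z.
  suff jv : joined v.
    have := @top_dominated z q v jz jv; rewrite Mq Mz Mv (negPf vz) (negPf vq).
    by move=> H; suff: false by []; apply: H => //; apply: zmin.
  have := L_le v; rewrite leq_eqVlt => /orP[/eqP Lv|]; last exact: joined_lt.
  have [b vb Lb] : exists2 u, e v u & (L u).+1 = L v.
    by apply: (level_parent LP); rewrite Lv.
  case: (boolP (lower_nbrs v \subset lower_nbrs y)) => [sub|/subsetPn[c cv cy]].
    have /eqP E : lower_nbrs v == lower_nbrs y by rewrite eqEcard sub lower_min.
    move/setP/(_ a): E; rewrite !mem_lower La ya eqxx !andbT => v_a.
    by move: va; rewrite nbhd_sym // mem_nbhd v_a orbT.
  exact: joined_lower cv cy.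
case: zx => [zx|zlt].
  by move: zy; rewrite zx; apply: avoids_refl.
have := L_le z; rewrite leq_eqVlt => /orP[/eqP Lz|]; last exact: joined_lt.
case: (boolP (lower_nbrs z \subset lower_nbrs y)) => [sub|/subsetPn[c cv cy]].
  have /eqP E : lower_nbrs z == lower_nbrs y by rewrite eqEcard sub lower_min.
  move: zlt; rewrite ltnNge => /negP[]; apply: subset_leq_card.
  rewrite -{1}E; apply/subsetP => u uz.
  have := uz; rewrite E => /lower_y_M1 Mu; rewrite inE Mu eqxx andbT.
  by move: uz; rewrite mem_lower => /andP[].
exact: joined_lower cv cy.
Qed.

(** The list is read from [y] upwards, because vertices are prepended while the path is built down
    from [z]. *)
Definition descends a b : bool :=
  [&& e b a, (M a).+1 == M b & [forall u, e b u ==> (M u == M a) ==> (L a <= L u)]].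

(** The outcome of the scan for [z]. When the eccentricity [k.+1] is at most 2, the scan starts with
    [x] as candidate and the count of [y] as value to beat, whence the two alternatives. *)
Definition good_end z : Prop :=
  [/\ 2 <= k, M z = m &
      forall w, M w = m -> #|nbrs_at M m.-1 z| <= #|nbrs_at M m.-1 w|] \/
  [/\ k < 2, m <= 2 &
      (z = x /\ forall w, M w = m -> #|lower_nbrs y| <= #|nbrs_at M m.-1 w|) \/
      [/\ M z = m, #|nbrs_at M m.-1 z| < #|lower_nbrs y| &
          forall w, M w = m -> #|nbrs_at M m.-1 z| <= #|nbrs_at M m.-1 w|]].

(** * From the dominating path to a paired dominating set *)

Section Finish.
Variable rest : seq T.
Hypotheses (rest_n0 : rest != [::]) (rest_path : path descends y rest).
Hypothesis rest_end : good_end (last y rest).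

Local Notation s := (y :: rest).
Local Notation p := (nth y s).

Lemma descends_nth i : i < size rest -> descends (p i) (p i.+1).
Proof. by move/(pathP y): rest_path; apply. Qed.

Lemma path_level i : i <= size rest -> M (p i) = i.
Proof.
elim: i => [|i IH] ih; first by rewrite /= (level_src MP).
by have /and3P[_ /eqP<- _] := descends_nth ih; rewrite IH // ltnW.
Qed.

Lemma path_adj i : i < size rest -> e (p i.+1) (p i).
Proof. by case/descends_nth/and3P. Qed.

Lemma path_lowest i u : i < size rest -> e (p i.+1) u -> M u = i -> L (p i) <= L u.
Proof.
move=> ih iu Mu; case/and3P: (descends_nth ih) => _ _ /forallP/(_ u).
by rewrite iu Mu path_level ?(ltnW ih) // eqxx.
Qed.

Lemma path_uniq : uniq s.
Proof.
apply: (@map_uniq _ _ M); rewrite (_ : map M s = iota 0 (size s)) ?iota_uniq //.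
apply: (@eq_from_nth _ 0) => [|i]; rewrite size_map ?size_iota // => ih.
by rewrite (nth_map y) // nth_iota // path_level.
Qed.

Lemma path_sorted_e : sorted e s.
Proof. by apply: sub_path rest_path => a b /and3P[]; rewrite e_sym. Qed.

(** Only when [k < 2] and the path has three vertices may a lower neighbour [a] of [y] be required
    in addition. *)
Lemma covered v : (exists2 u, u \in s & v \in N u) \/
  (odd (size s) /\ forall a, e y a -> L a = k -> v \in N a).
Proof.
have ph : p (size rest) = last y rest by rewrite (nth_last y s).
have h_gt0 : 0 < size rest by case: (rest) rest_n0.
have mem_p i : i <= size rest -> p i \in s by move=> ih; apply: mem_nth.
case: rest_end => [[k2 Mz zmin]|[k2 m2 zsel]].
  left; have mh : m = size rest by rewrite -Mz -ph path_level.
  have [i ih vi] : exists2 i, i <= size rest & v \in N (p i).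
    apply: (path_dominates_long path_level path_adj path_lowest) => // w Mw.
    by rewrite ph -mh; apply: zmin; rewrite mh.
  by exists (p i); first exact: mem_p.
(* For [k = 0] the vertex [x] dominates the graph and is the only lower neighbour of [y]. *)
case: (posnP k) => [k0|k_gt0].
  have vx : v \in N x.
    rewrite mem_nbhd; case: LP => L0 Lz _ _.
    case: (posnP (L v)) => [/Lz->|Lv]; first by rewrite eqxx.
    by rewrite -(level1 e_sym e_irr LP) eqn_leq Lv -{1}k0 L_le orbT.
  case: (boolP (odd (size s))) => [s_odd|s_even]; [right|left].
    by split=> // a ya; rewrite k0; case: LP => L0 Lz _ _ /Lz ->.
  exists x => //; have h1 : size rest = 1.
    have := M_le (last y rest); rewrite -ph path_level //.
    by move: s_even h_gt0 m2 => /=; case: (size rest) => [|[|[|h]]] //; lia.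
  (* A path on two vertices ends in [x]: an end that beat it would have fewer neighbours on level 0
     than [y] has lower ones, of which there is at most one, although [y] is such a neighbour. *)
  case: zsel => [[<- _]|[Mz H _]]; first exact: mem_last.
  have mE : m = 1 by rewrite -Mz -ph h1 path_level ?h1.
  have ltE : #|lower_nbrs y| <= 1.
    rewrite -(cards1 x); apply: subset_leq_card; apply/subsetP => u.
    by rewrite !inE k0; case: LP => _ Lz _ _ /andP[_ /eqP/Lz->].
  have : y \in nbrs_at M m.-1 (last y rest).
    by rewrite inE mE (level_src MP) eqxx andbT -ph h1; apply: path_adj; rewrite h1.
  by move=> yz; have : 0 < #|nbrs_at M m.-1 (last y rest)| by [apply/card_gt0P; exists y]; lia.
have k1 : k = 1 by lia.
have Mx : M x = 2.
  apply/eqP; rewrite eqn_leq (leq_trans (M_le x) m2) /=.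
  have : y \notin N x by rewrite -(level_gt1 e_sym e_irr LP) Ly k1.
  by rewrite nbhd_sym // -(level_gt1 e_sym e_irr MP).
have mE : m = 2 by have := M_le x; lia.
(* Both sets are the common neighbours of [x] and [y], so the value to beat is the count of [x]
   itself. *)
have lower_x : nbrs_at M 1 x = lower_nbrs y.
  apply/setP => u; rewrite !inE (level1 e_sym e_irr MP).
  by rewrite k1 (level1 e_sym e_irr LP) andbC.
set z := last y rest in ph zsel *.
have [Mz zmin zx] : [/\ M z = 2,
    forall w, M w = 2 -> #|nbrs_at M 1 z| <= #|nbrs_at M 1 w| &
    z = x \/ #|nbrs_at M 1 z| < #|lower_nbrs y|].
  rewrite mE /= in zsel; case: zsel => [[zE H]|[Mz H1 H2]]; last by split=> //; right.
  by rewrite zE; split=> // [w /H|]; [rewrite lower_x|left].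
have h2 : size rest = 2 by rewrite -Mz -ph path_level.
have zq : e z (p 1) by rewrite -ph h2; apply: path_adj; rewrite h2.
have Mq : M (p 1) = 1 by rewrite path_level // h2.
case: (boolP [|| v \in N z, v \in N (p 1) | v \in N y]) => [H|nH];
  [left|right; split; first by rewrite /= h2].
  case/or3P: H => H; [exists z|exists (p 1)|exists y]; rewrite // ?mem_p ?h2 //.
    by rewrite -ph mem_p.
  by rewrite inE eqxx.
move=> a ya La; have := short_dominated v m2 ya La zq Mz Mq zmin zx.
by move: nH; rewrite !negb_or => /and3P[/negPf-> /negPf-> /negPf->].
Qed.

Definition good_pd_set (D : {set T}) : Prop :=
  pd_set e D /\ #|D| <= 2 * gamma_pr e.

(** The path occupies the levels below [size s], and the rounding in [pd_set_levels] leaves room for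
    one more vertex when [size s] is odd. *)
Lemma pd_path_good (t : seq T) : uniq t -> ~~ odd (size t) -> sorted e t ->
  (forall v, exists2 u, u \in t & v \in N u) ->
  size t <= size s + odd (size s) -> good_pd_set [set u in t].
Proof.
move=> t_uniq t_even t_path t_dom t_size; split; first exact: path_pd_set.
apply: gamma_pr_lower => S pdS; rewrite cardsE (card_uniqP t_uniq).
apply: leq_trans t_size (pd_set_levels e_sym e_irr MP pdS _) => i ih.
by exists (p i); rewrite path_level.
Qed.

Lemma lower_exists : exists2 a, e y a & L a = k.
Proof.
have [|a ya La] := @level_parent _ _ _ _ LP y; first by rewrite Ly.
by exists a => //; rewrite Ly in La; lia.
Qed.

Lemma path_even_good : ~~ odd (size s) -> good_pd_set [set u in s].
Proof.
move=> s_even; apply: pd_path_good; rewrite ?leq_addr //.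
- exact: path_uniq.
- exact: path_sorted_e.
by move=> v; case: (covered v) => // -[]; rewrite (negPf s_even).
Qed.

(** If some lower neighbour of [y] differs from [p 1], the choice of [q] makes [q] a lower neighbour
    too; otherwise [p 1], already on the path, is the lower neighbour that [covered] asks for. *)
Lemma path_add_good q : odd (size s) -> e y q -> q != p 1 ->
  (forall u, e y u -> u != p 1 -> L q <= L u) -> good_pd_set [set u in q :: s].
Proof.
move=> s_odd yq q1 qmin.
have q_s : q \notin s.
  apply/negP => /(nthP y)[i ih qE]; rewrite ltnS in ih.
  have := path_level ih; rewrite qE => Mq.
  have /eqP Mq1 : M q == 1 by rewrite (level1 e_sym e_irr MP).
  by move: q1; rewrite -qE -Mq Mq1 eqxx.
apply: pd_path_good.
- by rewrite cons_uniq q_s path_uniq.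
- by move: s_odd => /= ->.
- by rewrite /= e_sym yq; apply: path_sorted_e.
- move=> v; case: (covered v) => [[u us vu]|[_ va]].
    by exists u; rewrite // inE us orbT.
  have [a ya La] := lower_exists.
  case: (eqVneq a (p 1)) => [a1|a1].
    exists a; last exact: va.
    by rewrite a1 inE mem_nth ?orbT //; case: (rest) rest_n0.
  exists q; first by rewrite inE eqxx.
  apply: va => //; have := qmin a ya a1; have := level_adj e_sym LP yq; rewrite Ly La; lia.
- by rewrite s_odd addn1.
Qed.

(** [p 1] dominates all that [y] dominates, and is also the lower neighbour of [y]. *)
Lemma path_drop_good : odd (size s) -> (forall u, e y u -> u = p 1) ->
  good_pd_set [set u in rest].
Proof.
move=> s_odd y1; have h_gt0 : 0 < size rest by case: (rest) rest_n0.
have p1_in : p 1 \in rest by rewrite /= mem_nth.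
have y_p1 : e y (p 1) by have [a ya _] := lower_exists; rewrite -(y1 a ya).
apply: pd_path_good.
- by have /andP[] := path_uniq.
- by move: s_odd => /=.
- exact: path_sorted path_sorted_e.
- move=> v; case: (covered v) => [[u]|[_ va]].
    rewrite inE => /predU1P[->|us vu]; last by exists u.
    rewrite mem_nbhd => /orP[/eqP->|/y1->].
      by exists (p 1); rewrite // mem_nbhd e_sym y_p1 orbT.
    by exists (p 1); rewrite // mem_nbhd eqxx.
  have [a ya La] := lower_exists; exists a; last exact: va.
  by rewrite (y1 a ya).
- by rewrite /=; lia.
Qed.

End Finish.
End TwoSweeps.

(** * Program logic *)

(** Evaluation without the word bound; [fits] collects the bounds as a separate side condition, so
    that execution steps reduce to arithmetic. *)
Fixpoint value (s : state) (x : expr) : nat :=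
  match x with
  | Const k => k
  | Reg r => reg s r
  | Read a i => arr s a (value s i)
  | Bin o y z => binop_eval o (value s y) (value s z)
  end.

Fixpoint fits (W : nat) (s : state) (x : expr) : bool :=
  match x with
  | Const _ | Reg _ => value s x < W
  | Read _ i => fits W s i && (value s x < W)
  | Bin _ y z => [&& fits W s y, fits W s z & value s x < W]
  end.

Fixpoint wregs (p : cmd) : seq nat :=
  match p with
  | Assign r _ => [:: r]
  | Seq p q | If _ p q => wregs p ++ wregs q
  | While _ p => wregs p
  | _ => [::]
  end.

Fixpoint warrs (p : cmd) : seq nat :=
  match p with
  | Write a _ _ => [:: a]
  | Seq p q | If _ p q => warrs p ++ warrs q
  | While _ p => warrs p
  | _ => [::]
  end.

Definition frame (p : cmd) (s s' : state) : Prop :=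
  (forall r, r \notin wregs p -> reg s' r = reg s r) /\
  (forall a, a \notin warrs p -> arr s' a = arr s a).

Section ProgramLogic.
Variable W : nat.
Implicit Types (p q : cmd) (x : expr) (s : state) (c t : nat)
  (Q I : nat -> state -> Prop).

Lemma eval_value s x : fits W s x -> eval W s x = Some (value s x).
Proof.
elim: x => [k|r|a x IH|o x IHx z IHz] /=; rewrite /fit.
- by move->.
- by move->.
- by case/andP => /IH-> /= ->.
- by case/and3P => /IHx-> /IHz-> /= ->.
Qed.

Lemma frame_refl p s : frame p s s. Proof. by []. Qed.

Lemma frame_assign r x s v : frame (Assign r x) s (set_reg s r v).
Proof. by split=> // z; rewrite /= inE /upd => /negPf->. Qed.

Lemma frame_trans p s1 s2 s3 : frame p s1 s2 -> frame p s2 s3 -> frame p s1 s3.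
Proof.
by case=> [r1 a1] [r2 a2]; split=> z zp; rewrite ?r2 ?r1 ?a2 ?a1.
Qed.

Lemma frame_sub p q s s' : {subset wregs p <= wregs q} ->
  {subset warrs p <= warrs q} -> frame p s s' -> frame q s s'.
Proof.
by move=> rpq apq [Hr Ha]; split=> z zq; rewrite ?Hr ?Ha //; apply: contra zq; auto.
Qed.

Lemma exec_frame p s t s' : exec W p s t s' -> frame p s s'.
Proof.
elim=> {p s t s'} //.
- by move=> s r x v _; split=> //= z; rewrite inE /upd => /negPf->.
- by move=> s a x y i v _ _; split=> //= z; rewrite inE /upd => /negPf->.
- move=> p q s s1 s2 t1 t2 _ Hp _ Hq; apply: (@frame_trans _ s s1).
    by apply: frame_sub Hp => z /=; rewrite mem_cat => ->.
  by apply: frame_sub Hq => z /=; rewrite mem_cat => ->; rewrite orbT.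
- move=> x p q s s1 b t _ _ H; apply: frame_sub H => z;
    by rewrite /= mem_cat; case: ifP => _ ->; rewrite ?orbT.
- by move=> x p s s1 s2 b t1 t2 _ _ Hp _; apply: frame_trans Hp.
Qed.

(* Total correctness with time credits: [p], given [c] credits, halts within
   them, and [Q] is told how many are left. *)
Definition wp p Q c s : Prop :=
  exists t s', [/\ exec W p s t s', t <= c & Q (c - t) s'].

(** Lets every postcondition use for free that registers and arrays not written to keep their
    content. *)
Lemma wp_frame p Q c s :
  wp p (fun c' s' => frame p s s' -> Q c' s') c s -> wp p Q c s.
Proof.
case=> t [s' [H tc HQ]]; exists t, s'; split=> //.
by apply: HQ; apply: exec_frame H.
Qed.

Lemma wp_mono p Q Q' c s : (forall c' s', Q c' s' -> Q' c' s') ->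
  wp p Q c s -> wp p Q' c s.
Proof. by move=> QQ' [t [s' [H tc /QQ' HQ]]]; exists t, s'. Qed.

Lemma wp_skip Q c s : 0 < c -> Q c.-1 s -> wp Skip Q c s.
Proof. by exists 1, s; split=> //; [apply: exec_skip|rewrite subn1]. Qed.

Lemma wp_assign r x Q c s : fits W s x -> cost x < c ->
  Q (c - (cost x).+1) (set_reg s r (value s x)) -> wp (Assign r x) Q c s.
Proof.
move=> fx cx H; exists (cost x).+1, (set_reg s r (value s x)); split=> //.
by apply: exec_assign; apply: eval_value.
Qed.

Lemma wp_write a x y Q c s : fits W s x && fits W s y -> cost x + cost y < c ->
  Q (c - (cost x + cost y).+1) (set_arr s a (value s x) (value s y)) ->
  wp (Write a x y) Q c s.
Proof.
case/andP=> fx fy cx H; exists (cost x + cost y).+1, (set_arr s a (value s x) (value s y)).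
by split=> //; apply: exec_write; apply: eval_value.
Qed.

Lemma wp_seq p q Q c s : wp p (wp q Q) c s -> wp (Seq p q) Q c s.
Proof.
case=> t1 [s1 [H1 c1 [t2 [s2 [H2 c2 HQ]]]]]; exists (t1 + t2), s2; split.
- exact: exec_seq H1 H2.
- by lia.
- by rewrite subnDA.
Qed.

Lemma wp_if x p q Q c s : fits W s x -> cost x < c ->
  wp (if value s x != 0 then p else q) Q (c - (cost x).+1) s ->
  wp (If x p q) Q c s.
Proof.
move=> fx cx [t [s' [H tc HQ]]]; exists (cost x + t).+1, s'; split.
- by apply: exec_if H; apply: eval_value.
- by lia.
- by move: HQ; congr Q; lia.
Qed.

(** Every iteration spends credits, so induction on them proves termination without a separate
    variant. *)
Lemma wp_while x p I Q c s0 :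
  (forall c s, frame p s0 s -> I c s ->
     [/\ fits W s x, cost x < c &
         if value s x == 0 then Q (c - (cost x).+1) s
         else wp p I (c - (cost x).+1) s]) ->
  I c s0 -> wp (While x p) Q c s0.
Proof.
move=> H; suff G : forall s, frame p s0 s -> I c s -> wp (While x p) Q c s by apply: G.
elim/ltn_ind: c => c IH s fr Is.
have [fx cx] := H c s fr Is; case: eqP => [x0 HQ|/eqP].
  exists (cost x).+1, s; split=> //; apply: exec_while_false.
  by rewrite eval_value // x0.
case xE : (value s x) => [|b] // _ [t1 [s1 [H1 tc1 Is1]]].
have [||t2 [s2 [H2 tc2 HQ]]] := IH (c - (cost x).+1 - t1) _ s1 _ Is1.
- by lia.
- exact: frame_trans fr (exec_frame H1).
exists (cost x + t1 + t2).+1, s2; split.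
- by apply: exec_while_true H1 H2; rewrite eval_value // xE.
- by lia.
- by move: HQ; congr Q; lia.
Qed.

End ProgramLogic.

(** * Loops over the vertices and over an adjacency list *)

Notation rN := 0 (only parsing).
Notation rI := 1 (only parsing).
Notation rJ := 2 (only parsing).
Notation rStop := 3 (only parsing).
Notation rU := 4 (only parsing).

Definition for_vertices (body : cmd) : cmd :=
  Seq (Assign rI (Const 0))
      (While (Bin Lt (Reg rI) (Reg rN))
             (Seq body (Assign rI (Bin Add (Reg rI) (Const 1))))).

Definition for_nbrs (r : nat) (body : cmd) : cmd :=
  Seq (Assign rJ (Read 0 (Reg r)))
  (Seq (Assign rStop (Read 0 (Bin Add (Reg r) (Const 1))))
  (While (Bin Lt (Reg rJ) (Reg rStop))
     (Seq (Assign rU (Read 1 (Reg rJ)))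
     (Seq (Assign rJ (Bin Add (Reg rJ) (Const 1))) body)))).

Section GraphLoops.
Variables (n : nat) (adj : 'I_n -> seq 'I_n) (W : nat).

Definition offset (k : nat) : nat := \sum_(v < n | v < k) size (adj v).

Hypothesis W_large : n + offset n + 10 <= W.

Definition graph_in (s : state) : Prop :=
  [/\ reg s rN = n, forall k, k <= n -> arr s 0 k = offset k &
      forall v i, i < size (adj v) -> arr s 1 (offset v + i) = nth v (adj v) i].

Lemma graph_in_frame p s s' : 0 \notin wregs p -> (0 \notin warrs p) && (1 \notin warrs p) ->
  frame p s s' -> graph_in s -> graph_in s'.
Proof.
move=> r0 /andP[a0 a1] [Hr Ha] [gn go ga].
by split=> [|k|v i]; rewrite ?Hr ?Ha //; [apply: go|apply: ga].
Qed.

Lemma offsetS (v : 'I_n) : offset v.+1 = offset v + size (adj v).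
Proof.
rewrite /offset (bigD1 v) //= addnC; congr (_ + _); apply: eq_bigl => u.
by rewrite ltnS (ltn_neqAle u) andbC.
Qed.

Lemma offset_le k : offset k <= offset n.
Proof.
rewrite /offset [X in X <= _]big_mkcond [X in _ <= X]big_mkcond /=.
by apply: leq_sum => u _; rewrite ltn_ord; case: ifP.
Qed.

Lemma offset_total : offset n = \sum_v size (adj v).
Proof. by apply: eq_bigl => v; rewrite ltn_ord. Qed.

(** The lists before that of [v] fill exactly [offset v] cells, which locates [adj v] in the
    concatenation. *)
Lemma size_flatten_take (v : 'I_n) :
  size (flatten [seq adj u | u <- take v (enum 'I_n)]) = offset v.
Proof.
elim: {v}(nat_of_ord v) (ltnW (ltn_ord v)) => [|k IH] kn.
  by rewrite take0 /offset big_pred0.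
rewrite (take_nth (Ordinal kn)) ?size_enum_ord // (nth_ord_enum _ (Ordinal kn)).
by rewrite map_rcons -cats1 flatten_cat size_cat /= cats0 IH ?(offsetS (Ordinal kn)) // ltnW.
Qed.

Lemma graph_in_input : graph_in (input adj).
Proof.
split=> [|k kn|v i iv] //=.
  rewrite (nth_map 0) ?size_iota // nth_iota //.
rewrite -size_flatten_take.
rewrite /neighbours (nth_map v); last first.
  rewrite -{2}[enum 'I_n](cat_take_drop v) map_cat flatten_cat size_cat ltn_add2l.
  rewrite (drop_nth v) ?size_enum_ord // nth_ord_enum /= size_cat.
  exact: ltn_addr.
rewrite -{1}[enum 'I_n](cat_take_drop v) map_cat flatten_cat nth_cat ltnNge leq_addr /=.
rewrite addKn (drop_nth v) ?size_enum_ord // nth_ord_enum /= nth_cat iv.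
by [].
Qed.

(** The body may spend [f v] on vertex [v]; the 10 added to it covers the test and the increment of
    the loop. *)
Lemma wp_for_vertices (f : 'I_n -> nat) body (I : nat -> state -> Prop) Q c s :
  all [predC wregs body] [:: rN; rI] -> all [predC warrs body] [:: 0; 1] ->
  graph_in s ->
  (forall i s1 w, I i s1 -> I i (set_reg s1 rI w)) ->
  (forall (v : 'I_n) c1 s1, graph_in s1 -> frame (for_vertices body) s s1 ->
     I v s1 -> reg s1 rI = v -> f v <= c1 ->
     wp W body (fun c2 s2 => c1 <= c2 + f v /\ I v.+1 s2) c1 s1) ->
  I 0 s -> 10 + \sum_v (f v + 10) <= c ->
  (forall c' s', c <= c' + (10 + \sum_v (f v + 10)) -> graph_in s' ->
     frame (for_vertices body) s s' -> I n s' -> Q c' s') ->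
  wp W (for_vertices body) Q c s.
Proof.
set B := \sum_v _; rewrite /= !andbT => /andP[w0 w1] wa gs Irob Ibody I0 Bc HQ.
set loop := for_vertices body.
have fr_loop q s1 s2 : {subset wregs q <= rI :: wregs body} ->
    {subset warrs q <= warrs body} -> frame q s1 s2 -> frame loop s1 s2.
  move=> qr qa; apply: frame_sub => z; last by move/qa; rewrite /= cats0.
  by move/qr; rewrite /= !inE mem_cat inE; case: (z == _); rewrite ?orbT //= orbF.
(* [rest i] is the budget of the vertices from [i] on, a tail sum of [B]. *)
have [rest [rest0 restS]] : exists rest : nat -> nat,
    rest 0 = B /\ forall v : 'I_n, rest v = f v + 10 + rest v.+1.
  exists (fun i => \sum_(u : 'I_n | i <= u) (f u + 10)); split=> [|v]; first exact: eq_bigl.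
  rewrite (bigD1 v) //=; congr (_ + _); apply: eq_bigl => u.
  by rewrite (ltn_neqAle v) andbC eq_sym.
clearbody B.
apply: wp_frame; apply: wp_seq; apply: wp_assign => //=; try by lia.
(* Credits are compared without subtraction; the 4 is reserved for the final test of the guard. *)
refine (@wp_while W _ _ (fun c1 s1 => graph_in s1 /\
  exists i, [/\ i <= n, reg s1 rI = i, I i s1 &
    c + 4 + rest i <= c1 + 10 + B]) _ _ _ _ _); last first.
  split.
    exact: (@graph_in_frame (Assign rI (Const 0)) s _ _ _ (frame_assign _ _ _ _)).
  exists 0; split => //=; first exact: Irob.
  by lia.
move=> c1 s1 fr [gs1 [i [ilen ri Ii c1E]]].
have [n_s1 _ _] := gs1.
have fr0 : frame loop s s1.
  apply: (@frame_trans _ _ (set_reg s rI 0)).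
    apply: (fr_loop (Assign rI (Const 0))) (frame_assign _ _ _ _) => //= z.
    by rewrite !inE => ->.
  apply: fr_loop fr => z /=; last by rewrite cats0.
  by rewrite mem_cat !inE orbC.
rewrite /= ri n_s1; split; [by lia|by lia|].
case: (ltnP i n) => [lt_in|ge_in] /=; last first.
  move=> _; apply: HQ => //; first by lia.
  by have -> : n = i by lia.
pose v := Ordinal lt_in.
have := restS v; rewrite /= => restE; rewrite restE in c1E.
apply: wp_seq; apply: wp_frame.
apply: wp_mono (Ibody v (c1 - 4) s1 gs1 fr0 Ii ri _); last by lia.
move=> c2 s2 [c2E Iv] fr2.
have gs2 : graph_in s2.
  exact: graph_in_frame fr2 gs1.
have [n_s2 _ _] := gs2.
have ri2 : reg s2 rI = i by case: fr2 => -> //.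
apply: wp_assign => /=; rewrite ?ri2; [by lia|by lia|].
split; last by exists i.+1; rewrite addn1; split=> //=; [apply: (Irob)|lia].
exact: (@graph_in_frame (Assign rI (Const 0)) s2 _ _ _ (frame_assign _ _ _ _)).
Qed.

(** The invariant is indexed by the prefix of [adj v] already scanned, and [K] is the allowance of
    the body per neighbour. *)
Lemma wp_for_nbrs K r (v : 'I_n) body (I : seq 'I_n -> state -> Prop) Q c s :
  all [predC wregs body] [:: rN; rJ; rStop] -> all [predC warrs body] [:: 0; 1] ->
  graph_in s -> reg s r = v -> r != rJ ->
  (forall pre s1 x w, x \in [:: rJ; rStop; rU] -> I pre s1 -> I pre (set_reg s1 x w)) ->
  (forall pre u suf c1 s1, adj v = pre ++ u :: suf -> graph_in s1 ->
     frame (for_nbrs r body) s s1 ->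
     I pre s1 -> reg s1 rU = u -> K <= c1 ->
     wp W body (fun c2 s2 => c1 <= c2 + K /\ I (rcons pre u) s2) c1 s1) ->
  I [::] s -> 20 + (K + 20) * size (adj v) <= c ->
  (forall c' s', c <= c' + (20 + (K + 20) * size (adj v)) -> graph_in s' ->
     frame (for_nbrs r body) s s' -> I (adj v) s' -> Q c' s') ->
  wp W (for_nbrs r body) Q c s.
Proof.
rewrite /= !andbT => /and3P[w0 w1 w2] wa gs rv r2 Irob Ibody I0 Bc HQ.
set loop := for_nbrs r body.
have [n_s off_s adj_s] := gs.
have ltv := ltn_ord v; have offv := offset_le v; have offv1 := offset_le v.+1.
have offE := offsetS v.
have fr_loop q s1 s2 : {subset wregs q <= [:: rJ, rStop, rU & wregs body]} ->
    {subset warrs q <= warrs body} -> frame q s1 s2 -> frame loop s1 s2.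
  move=> qr qa; apply: frame_sub => z; last by move/qa.
  move/qr; rewrite /= !inE.
  by case: (z == rJ); case: (z == rStop); case: (z == rU); rewrite ?orbT.
apply: wp_frame; apply: wp_seq; apply: wp_assign => /=;
  rewrite ?rv ?off_s //; try lia.
apply: wp_seq; apply: wp_assign => /=; rewrite /upd ?(negPf r2) ?rv ?addn1 ?off_s //; try lia.
set s0 := set_reg _ _ _.
have fr_s0 : frame loop s s0.
  by split=> // z; rewrite /= !inE !negb_or => /and4P[zJ zS _ _];
    rewrite /upd (negPf zJ) (negPf zS).
refine (@wp_while W _ _ (fun c1 s1 => graph_in s1 /\
  exists pre suf, [/\ adj v = pre ++ suf, reg s1 rJ = offset v + size pre,
    reg s1 rStop = offset v.+1, I pre s1 &
    c + 4 + (K + 20) * size suf <= c1 + 20 + (K + 20) * size (adj v)]) _ _ _ _ _); last first.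
  split; first by apply: graph_in_frame fr_s0 gs => //=.
  exists [::], (adj v); rewrite addn0; split => //=; last by lia.
  by apply: (Irob); rewrite ?inE //; apply: (Irob); rewrite ?inE.
move=> c1 s1 fr [gs1 [pre [suf [adjE rJE rSE Ipre c1E]]]].
have [n_s1 _ adj_s1] := gs1.
have fr0 : frame loop s s1.
  apply: frame_trans fr_s0 _; apply: fr_loop fr => z //=.
  by rewrite !inE; case: (z == rJ); case: (z == rU); rewrite ?orbT //= => ->; rewrite ?orbT.
have sizeE : size (adj v) = size pre + size suf by rewrite adjE size_cat.
rewrite /= rJE rSE; split; [by lia|by lia|].
case: suf adjE c1E sizeE => [|u suf] /= adjE c1E sizeE.
  rewrite offE ltnNge sizeE !addn0 leqnn /= => _; apply: HQ => //; first by lia.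
  by rewrite cats0 in adjE; rewrite adjE.
rewrite offE ltn_add2l sizeE addnS ltnS leq_addr /=.
have uE : arr s1 1 (offset v + size pre) = u.
  by rewrite adj_s1 ?adjE ?nth_cat ?ltnn ?subnn // size_cat /=; lia.
have ltu := ltn_ord u; rewrite mulnS in c1E.
apply: wp_seq; apply: wp_assign => /=; rewrite ?rJE ?uE //; try lia.
apply: wp_seq; apply: wp_assign => /=; rewrite /upd /= ?rJE; try lia.
set s2 := set_reg _ _ _; apply: wp_frame.
have fr2 : frame loop s1 s2.
  by split=> // z; rewrite /= !inE !negb_or => /and4P[zJ _ zU _];
    rewrite /upd (negPf zJ) (negPf zU).
have gs2 : graph_in s2 by apply: graph_in_frame fr2 gs1 => //=.
apply: wp_mono (Ibody pre u suf _ s2 adjE gs2 (frame_trans fr0 fr2) _ _ _) => //; last 2 first.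
- by apply: (Irob); rewrite ?inE //; apply: (Irob); rewrite ?inE.
- by lia.
move=> c3 s3 [c3E I3] fr3; split.
  exact: graph_in_frame fr3 gs2.
exists (rcons pre u), suf; rewrite cat_rcons size_rcons addnS; case: fr3 => Hr _.
by split=> //; rewrite ?Hr //= /upd /= ?rJE ?rSE; lia.
Qed.

End GraphLoops.

(** * The algorithm *)

Notation rCnt := 12 (only parsing).
Notation rBest := 13 (only parsing).
Notation rArg := 14 (only parsing).

(** [rBest] and [rArg] are set by the caller: they act as an initial candidate, displaced only by a
    strictly smaller count. The counts of all vertices, whether or not they pass [flt], remain in
    array [a]. *)
Definition argmin (a : nat) (flt pr : expr) : cmd :=
  for_vertices
    (Seq (Assign rCnt (Const 0))
    (Seq (for_nbrs rI (If pr (Assign rCnt (Bin Add (Reg rCnt) (Const 1))) Skip))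
    (Seq (Write a (Reg rI) (Reg rCnt))
         (If flt
            (If (Bin Lt (Reg rCnt) (Reg rBest))
               (Seq (Assign rBest (Reg rCnt)) (Assign rArg (Reg rI))) Skip)
            Skip)))).

(** The number of vertices exceeds every level, so with levels as keys it survives in [rBest] only
    if no neighbour passes the filter. *)
Definition best_nbr (r : nat) (flt key : expr) : cmd :=
  Seq (Assign rBest (Reg rN))
      (for_nbrs r
         (If flt (If (Bin Lt key (Reg rBest))
                    (Seq (Assign rBest key) (Assign rArg (Reg rU))) Skip)
             Skip)).

Ltac solve_sub := let z := fresh in
  move=> z; rewrite /= ?inE; repeat (case: (z == _); rewrite ?orbT //=).

Section Selection.
Variables (n : nat) (e : rel 'I_n) (adj : 'I_n -> seq 'I_n) (W : nat).
Hypothesis adjP : adjacency_lists e adj.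
Hypothesis W_large : n + offset adj n + 10 <= W.

Lemma mem_adj u v : (u \in adj v) = e v u.
Proof. by have [_ ->] := adjP v. Qed.

Lemma card_nbrs (P : pred 'I_n) v : #|[set u | e v u && P u]| = count P (adj v).
Proof.
have [uadj _] := adjP v; rewrite -size_filter -(card_uniqP (filter_uniq P uadj)).
by apply: eq_card => u; rewrite inE mem_filter mem_adj andbC.
Qed.

Lemma size_adj_le v : size (adj v) <= offset adj n.
Proof. by rewrite offset_total (bigD1 v) //= leq_addr. Qed.

(** A vertex pays for its own list only, so the total is linear in the number of vertices and the
    sum of degrees. *)
Lemma wp_argmin a flt pr (F : pred 'I_n) (P : 'I_n -> pred 'I_n) Q c s :
  let cnt v := #|[set u | e v u && P v u]| in
  let B := 10 + \sum_v (100 + 50 * size (adj v)) in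
  1 < a -> graph_in adj s -> reg s rBest < W ->
  (forall s1 v, frame (argmin a flt pr) s s1 -> reg s1 rI = val v ->
     [/\ fits W s1 flt, cost flt <= 20 & (value s1 flt != 0) = F v]) ->
  (forall s1 v u, frame (argmin a flt pr) s s1 -> reg s1 rI = val v ->
     reg s1 rU = val u ->
     [/\ fits W s1 pr, cost pr <= 20 & (value s1 pr != 0) = P v u]) ->
  B <= c ->
  (forall c' s', c <= c' + B -> graph_in adj s' -> frame (argmin a flt pr) s s' ->
     (forall v : 'I_n, arr s' a v = cnt v) ->
     reg s' rBest <= reg s rBest ->
     (forall v, F v -> reg s' rBest <= cnt v) ->
     (reg s' rBest = reg s rBest /\ reg s' rArg = reg s rArg) \/
     (exists v, [/\ F v, reg s' rArg = val v, reg s' rBest = cnt v &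
        cnt v < reg s rBest]) ->
     Q c' s') ->
  wp W (argmin a flt pr) Q c s.
Proof.
move=> cnt B a1 gs best_lt fltP prP Bc HQ.
have [a_0 a_1] : a != 0 /\ a != 1 by split; lia.
pose best0 := reg s rBest; pose arg0 := reg s rArg.
pose I i s1 :=
  [/\ forall v : 'I_n, v < i -> arr s1 a v = cnt v,
      reg s1 rBest <= best0, forall v : 'I_n, v < i -> F v -> reg s1 rBest <= cnt v &
     (reg s1 rBest = best0 /\ reg s1 rArg = arg0) \/
     (exists v, [/\ F v, reg s1 rArg = val v, reg s1 rBest = cnt v &
        cnt v < best0])].
apply: (wp_for_vertices W_large (f := fun v => 90 + 50 * size (adj v)) (I := I)) => //.
- by rewrite /= !inE ?negb_or ![_ == a]eq_sym a_0 a_1.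
- move=> v c1 s1 gs1 fr1 Iv riv c1_ge.
  have ltv := ltn_ord v; have cnt_ge := size_adj_le v.
  apply: wp_seq; apply: wp_assign => /=; try lia.
  apply: wp_seq.
  pose J pre s2 := [/\ I v s2, reg s2 rI = v & reg s2 rCnt = count (P v) pre].
  have fr_in r w s2 : r \in [:: rI; rJ; rStop; rU; rCnt; rBest; rArg] ->
      frame (argmin a flt pr) s s2 -> frame (argmin a flt pr) s (set_reg s2 r w).
    move=> rin [Hr Ha]; split=> // z zin; rewrite /= /upd; case: eqP => [zr|_]; last exact: Hr.
    by move: rin zin; rewrite -zr /= !inE; repeat (case: (z == _); rewrite ?orbT //=).
  apply: (wp_for_nbrs W_large (K := 30) (v := v) (I := J)) => //=.
  + by move=> pre s2 x w; rewrite !inE => /or3P[]/eqP-> [Is ri rc]; split=> //.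
  + move=> pre u suf c2 s2 adjE gs2 fr2 [Is2 ri rc] ru c2_ge.
    have fr02 : frame (argmin a flt pr) s s2.
      apply: frame_trans (fr_in rCnt 0 _ _ fr1) _ => //.
      by apply: frame_sub fr2; solve_sub.
    have [fp cp vp] := prP s2 v u fr02 ri ru.
    have adjn : size (adj v) = size pre + (size suf).+1 by rewrite adjE size_cat.
    have cl := count_size (P v) pre.
    apply: wp_if => //; first by lia.
    rewrite vp; case: ifP => Pvu.
      apply: wp_assign => /=; rewrite ?rc; try lia.
      split; first by lia.
      by split=> //=; rewrite /upd /= -cats1 count_cat /= Pvu ?rc; lia.
    apply: wp_skip; first by lia.
    split; first by lia.
    by split=> //=; rewrite -cats1 count_cat /= Pvu ?rc; lia.
  + lia.
  move=> c2 s2 c2_ge gs2 fr2 [Is2 ri rc].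
  rewrite -card_nbrs -/(cnt v) in rc.
  have cntv : cnt v <= size (adj v) by rewrite /cnt card_nbrs count_size.
  apply: wp_seq; apply: wp_write => /=; rewrite ?ri ?rc; try lia.
  set s3 := set_arr _ _ _ _.
  have fr3 : frame (argmin a flt pr) s s3.
    apply: frame_trans (fr_in rCnt 0 _ _ fr1) _ => //.
    apply: (@frame_trans _ _ s2); first by apply: frame_sub fr2; solve_sub.
    by split=> // z; rewrite /= !inE /upd => /negPf->.
  have [ff cf vf] := fltP s3 v fr3 ri.
  case: Is2 => I1 I2 I3 I4.
  have I1' (w : 'I_n) : w < v.+1 -> arr s3 a w = cnt w.
    rewrite ltnS leq_eqVlt /= /upd eqxx => /orP[/eqP wv|wv].
      by rewrite wv eqxx; congr cnt; apply: val_inj.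
    by rewrite ltn_eqF // I1.
  have bW : best0 < W by [].
  apply: wp_if; rewrite ?ff //; first by lia.
  rewrite vf; case: ifP => Fv.
    apply: wp_if; rewrite /= ?rc; try lia.
    case: (ltnP (cnt v) (reg s2 rBest)) => cb /=.
      apply: wp_seq; apply: wp_assign => /=; rewrite ?rc; try lia.
      apply: wp_assign => /=; rewrite /upd /= ?ri; try lia.
      split; first by lia.
      split=> //=; rewrite /upd /= ?ri; try lia.
        move=> w; rewrite ltnS leq_eqVlt => /orP[/eqP wv _|wv Fw].
          by rewrite (val_inj wv : w = v).
        by have := I3 w wv Fw; lia.
      by right; exists v; split=> //; lia.
    apply: wp_skip; first by lia.
    split; first by lia.
    split=> //= w; rewrite ltnS leq_eqVlt => /orP[/eqP wv _|wv Fw].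
      by rewrite (val_inj wv : w = v).
    exact: I3.
  apply: wp_skip; first by lia.
  split; first by lia.
  split=> //= w; rewrite ltnS leq_eqVlt => /orP[/eqP wv|wv]; last exact: I3.
  by rewrite (val_inj wv : w = v) Fv.
- by rewrite /I; split=> //; left.
- by move: Bc; rewrite /B (eq_bigr (fun v => 90 + 50 * size (adj v) + 10)) // => v _; lia.
- move=> c' s' c'_ge gs' fr' [I1 I2 I3 I4]; apply: HQ => //.
  + by rewrite /B (eq_bigr (fun v => 90 + 50 * size (adj v) + 10)) // => v _; lia.
  + by move=> v; apply: I1.
  + by move=> v; apply: I3.
Qed.

Lemma wp_best_nbr r (v : 'I_n) flt key (F : pred 'I_n) (k : 'I_n -> nat) Q c s :
  let B := 30 + 90 * size (adj v) in
  graph_in adj s -> reg s r = v -> r \notin [:: rJ; rBest] ->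
  (forall s1 u, frame (best_nbr r flt key) s s1 -> reg s1 rU = val u ->
     [/\ fits W s1 flt, cost flt <= 20 & (value s1 flt != 0) = F u]) ->
  (forall s1 u, frame (best_nbr r flt key) s s1 -> reg s1 rU = val u ->
     [/\ fits W s1 key, cost key <= 20 & value s1 key = k u]) ->
  B <= c ->
  (forall c' s', c <= c' + B -> graph_in adj s' -> frame (best_nbr r flt key) s s' ->
     (forall u, e v u -> F u -> reg s' rBest <= k u) ->
     reg s' rBest = n \/
     (exists u, [/\ e v u, F u, reg s' rArg = val u, reg s' rBest = k u & k u < n]) ->
     Q c' s') ->
  wp W (best_nbr r flt key) Q c s.
Proof.
move=> B gs rv; rewrite !inE negb_or => /andP[nJ nB] fltP keyP Bc HQ.
have [n_s _ _] := gs; have ltv := ltn_ord v.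
pose I (pre : seq 'I_n) s1 := reg s1 rBest <= n /\
  [/\ forall u, u \in pre -> F u -> reg s1 rBest <= k u &
     reg s1 rBest = n \/
     (exists u, [/\ e v u, F u, reg s1 rArg = val u, reg s1 rBest = k u & k u < n])].
have fr_in z w s2 : z \in [:: rJ; rStop; rU; rBest; rArg] ->
    frame (best_nbr r flt key) s s2 -> frame (best_nbr r flt key) s (set_reg s2 z w).
  move=> zin [Hr Ha]; split=> // x xin; rewrite /= /upd; case: eqP => [xz|_]; last exact: Hr.
  by move: zin xin; rewrite -xz /= !inE; repeat (case: (x == _); rewrite ?orbT //=).
apply: wp_seq; apply: wp_assign => /=; rewrite ?n_s; try lia.
apply: (wp_for_nbrs W_large (K := 70) (v := v) (I := I)) => //=.
- by rewrite /upd (negPf nB).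
- by move=> pre s2 x w; rewrite !inE => /or3P[]/eqP-> [I1 [I2 I3]].
- move=> pre u suf c1 s1 adjE gs1 fr1 [I1 [I2 I3]] ru c1_ge.
  have fr : frame (best_nbr r flt key) s s1.
    apply: frame_trans (fr_in rBest n _ _ (frame_refl _ _)) _ => //.
    by apply: frame_sub fr1; solve_sub.
  have [ff cf vf] := fltP s1 u fr ru; have [fk ck vk] := keyP s1 u fr ru.
  have vu : e v u by rewrite -mem_adj adjE mem_cat inE eqxx orbT.
  have ltu := ltn_ord u.
  apply: wp_if => //; first by lia.
  rewrite vf; case: ifP => Fu.
    apply: wp_if; rewrite /= ?fk ?vk; try lia.
    case: (ltnP (k u) (reg s1 rBest)) => kb /=.
      apply: wp_seq; apply: wp_assign => //=; first by lia.
      apply: wp_assign => /=; rewrite /upd /= ?ru ?vk; try lia.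
      split; first by lia.
      split; rewrite /= /upd /= ?vk; first by lia.
      split; last by right; exists u; split=> //; lia.
      move=> w; rewrite mem_rcons inE => /predU1P[-> //|wp Fw].
      by have := I2 w wp Fw; lia.
    apply: wp_skip; first by lia.
    split; first by lia.
    split=> //; split=> // w; rewrite mem_rcons inE => /predU1P[-> //|wp Fw].
    exact: I2.
  apply: wp_skip; first by lia.
  split; first by lia.
  split=> //; split=> // w; rewrite mem_rcons inE => /predU1P[->|wp]; first by rewrite Fu.
  exact: I2.
- by split=> //; split=> //; left.
- by rewrite /B in Bc; lia.
move=> c' s' c'_ge gs' fr' [I1 [I2 I3]]; apply: HQ => //.
- by rewrite /B; lia.
- apply: frame_trans (fr_in rBest n _ _ (frame_refl _ _)) _ => //.
  by apply: frame_sub fr'; solve_sub.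
- by move=> u vu; apply: I2; rewrite mem_adj.
Qed.

End Selection.

(** * Breadth-first search *)

Notation rHead := 5 (only parsing).
Notation rTail := 6 (only parsing).
Notation rV := 7 (only parsing).
Notation rSrc := 8 (only parsing).
Notation rEcc := 9 (only parsing).

(* Array 4 receives the distances, with [n] for "not visited yet"; array 5 is
   the queue. *)
Definition bfs : cmd :=
  Seq (for_vertices (Write 4 (Reg rI) (Reg rN)))
  (Seq (Write 4 (Reg rSrc) (Const 0))
  (Seq (Write 5 (Const 0) (Reg rSrc))
  (Seq (Assign rHead (Const 0))
  (Seq (Assign rTail (Const 1))
  (Seq (While (Bin Lt (Reg rHead) (Reg rTail))
     (Seq (Assign rV (Read 5 (Reg rHead)))
     (Seq (Assign rHead (Bin Add (Reg rHead) (Const 1)))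
     (for_nbrs rV
        (If (Bin Eq (Read 4 (Reg rU)) (Reg rN))
            (Seq (Write 4 (Reg rU) (Bin Add (Read 4 (Reg rV)) (Const 1)))
            (Seq (Write 5 (Reg rTail) (Reg rU))
                 (Assign rTail (Bin Add (Reg rTail) (Const 1)))))
            Skip)))))
  (Assign rEcc (Read 4 (Reg rV)))))))).

Section BreadthFirst.
Variables (n : nat) (e : rel 'I_n) (src : 'I_n).
Implicit Types (d : 'I_n -> nat) (qs dn : seq 'I_n).

(* The queue [qs] keeps the dequeued vertices; [dn] is its dequeued prefix. *)
Record queue_inv d qs dn (top : nat) : Prop := QueueInv {
  q_uniq : uniq qs;
  q_src : src \in qs;
  q_visited : forall v, (v \in qs) = (d v != n);
  q_root : d src = 0;
  q_zero : forall v, d v = 0 -> v = src;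
  q_sorted : {in qs &, forall u v, index u qs <= index v qs -> d u <= d v};
  q_index : {in qs, forall v, d v <= index v qs};
  q_top : {in qs, forall v, d v <= top};
  q_parent : {in qs, forall v, 0 < d v -> exists u, [/\ u \in dn, e v u & (d u).+1 = d v]}
}.

Definition scanned d qs dn : Prop :=
  forall u v, u \in dn -> e u v -> v \in qs /\ d v <= (d u).+1.

Lemma queue_inv_add d d' qs dn u v : v \in dn -> v \in qs -> e u v ->
  d' u = (d v).+1 -> (forall w, w != u -> d' w = d w) ->
  u \notin qs -> size qs < n -> queue_inv d qs dn (d v).+1 ->
  queue_inv d' (rcons qs u) dn (d' v).+1.
Proof.
move=> vdn vqs uv d'u d'E uqs qn [H1 H2 H3 H4 H5 H6 H7 H8 H9].
have d'q w : w \in qs -> d' w = d w.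
  by move=> wq; apply: d'E; apply: contraNneq uqs => <-.
(* A label is at most the position in the queue, so the new label stays below the marker [n]. *)
have dv : (d v).+1 <= size qs.
  by apply: leq_ltn_trans (H7 v vqs) _; rewrite index_mem.
have iq w : w \in qs -> index w (rcons qs u) = index w qs.
  by move=> wq; rewrite -cats1 index_cat wq.
have iu : index u (rcons qs u) = size qs.
  by rewrite -cats1 index_cat (negPf uqs) /= eqxx addn0.
have mq w : (w \in rcons qs u) = (w == u) || (w \in qs) by rewrite mem_rcons inE.
have lt_iq w : w \in qs -> index w qs < size qs by rewrite index_mem.
split.
- by rewrite rcons_uniq uqs.
- by rewrite mq H2 orbT.
- move=> w; rewrite mq; case: (eqVneq w u) => [->|wu].
    by rewrite d'u ltn_eqF //; lia.
  by rewrite d'E // H3.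
- by rewrite d'q.
- move=> w; case: (eqVneq w u) => [->|wu]; first by rewrite d'u.
  by rewrite d'E //; apply: H5.
- move=> a b; rewrite !mq => /predU1P[->|aq] /predU1P[->|bq] //.
  + by rewrite iu iq //; have := lt_iq b bq; lia.
  + by rewrite d'u (d'q _ aq) => _; apply: H8.
  + by rewrite !iq // !d'q //; apply: H6.
- move=> w; rewrite mq => /predU1P[->|wq]; first by rewrite iu d'u.
  by rewrite iq // d'q //; apply: H7.
- move=> w; rewrite mq (d'q v vqs) => /predU1P[->|wq]; first by rewrite d'u.
  by rewrite d'q //; apply: H8.
- move=> w; rewrite mq => /predU1P[-> _|wq].
    by exists v; split; rewrite // d'u d'q.
  rewrite d'q // => /(H9 w wq)[b [bdn wb db]].
  (* An unvisited parent would have label [n], making [d w] too large for a queued vertex. *)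
  case: (boolP (b \in qs)) => bq; first by exists b; rewrite d'q.
  have := H3 b; have := H3 w; rewrite wq (negPf bq) => /esym dw /esym/negbFE/eqP db'.
  have := H7 w wq; have := lt_iq w wq; nlia.
Qed.

(** Labels do not decrease along the queue, so the last dequeued vertex gives the eccentricity. *)
Lemma queue_inv_le_last d qs dn top : queue_inv d qs dn top ->
  {in qs, forall v, d v <= d (last src qs)}.
Proof.
case=> uq sq _ _ _ so _ _ _ v vq.
case: qs uq sq vq so => [//|w qs] uq sq vq so.
change (last src (w :: qs)) with (last w qs); apply: so; rewrite ?mem_last //.
by rewrite (index_last uq) -ltnS -[(size qs).+1]/(size (w :: qs)) index_mem.
Qed.

(** Once the queue is exhausted, connectivity puts every vertex in it; [scanned] gives the bound
    along edges and [q_parent] the parents. *)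
Lemma queue_inv_level d qs top : symmetric e -> (forall u v, connect e u v) ->
  queue_inv d qs qs top -> scanned d qs qs ->
  is_level e src d /\ forall v, v \in qs.
Proof.
move=> e_sym conn [H1 H2 H3 H4 H5 H6 H7 H8 H9] sc.
have qall v : v \in qs.
  have /connectP[p] := conn src v; elim/last_ind: p v => [|p w IH] v /=.
    by move=> _ ->.
  rewrite rcons_path last_rcons => /andP[pp ew] ->.
  by have [] := sc _ _ (IH _ pp erefl) ew.
split=> //; split=> //.
- by move=> u v uv; rewrite e_sym in uv; have [] := sc v u (qall v) uv.
- by move=> v v0; have [u [_ vu du]] := H9 v (qall v) v0; exists u.
Qed.

Variables (adj : 'I_n -> seq 'I_n) (W : nat).
Hypothesis adjP : adjacency_lists e adj.
Hypothesis W_large : n + offset adj n + 10 <= W.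
Hypotheses (e_sym : symmetric e) (conn : forall u v, connect e u v).

(** Potential for the amortized cost: each vertex pays for one scan, when it is dequeued. *)
Definition bfs_pot dn : nat := \sum_(v | v \notin dn) (40 + 40 * size (adj v)).

Lemma bfs_potS dn v : v \notin dn ->
  bfs_pot dn = 40 + 40 * size (adj v) + bfs_pot (rcons dn v).
Proof.
move=> vdn; rewrite /bfs_pot (bigD1 v) //=; congr (_ + _); apply: eq_bigl => u.
by rewrite mem_rcons inE negb_or andbC.
Qed.

Definition bfs_state d qs dn (s : state) : Prop :=
  [/\ forall v : 'I_n, arr s 4 v = d v, forall i, i < size qs -> arr s 5 i = nth src qs i,
      reg s rHead = size dn & reg s rTail = size qs].

(** Labels in the queue never exceed [(d v).+1] during the scan, so a neighbour visited earlier
    already meets the bound of [scanned], and a new one can join the rear with exactly this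
    label. *)
Lemma wp_bfs_scan d dn v pend Q c s : graph_in adj s ->
  let qs := dn ++ v :: pend in
  queue_inv d qs (rcons dn v) (d v).+1 -> bfs_state d qs (rcons dn v) s ->
  scanned d qs dn -> reg s rV = v -> 20 + 40 * size (adj v) <= c ->
  (forall c' s' d' pend', c <= c' + (20 + 40 * size (adj v)) -> graph_in adj s' ->
     let qs := dn ++ v :: pend' in
     queue_inv d' qs (rcons dn v) (d' v).+1 -> bfs_state d' qs (rcons dn v) s' ->
     scanned d' qs (rcons dn v) -> reg s' rV = v -> Q c' s') ->
  wp W
    (for_nbrs rV
        (If (Bin Eq (Read 4 (Reg rU)) (Reg rN))
            (Seq (Write 4 (Reg rU) (Bin Add (Read 4 (Reg rV)) (Const 1)))
            (Seq (Write 5 (Reg rTail) (Reg rU))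
                 (Assign rTail (Bin Add (Reg rTail) (Const 1)))))
            Skip)) Q c s.
Proof.
move=> gs qs0 qinv0 st0 sc0 rv0 c_ge HQ.
pose J (pre : seq 'I_n) s1 := reg s1 rV = v /\ exists d1 pend1, let qs := dn ++ v :: pend1 in
  [/\ queue_inv d1 qs (rcons dn v) (d1 v).+1, bfs_state d1 qs (rcons dn v) s1,
      scanned d1 qs dn & forall u, u \in pre -> u \in qs /\ d1 u <= (d1 v).+1].
apply: (wp_for_nbrs W_large (K := 20) (v := v) (I := J)) => //=.
- move=> pre s1 x w; rewrite !inE => /or3P[]/eqP-> [rv [d1 [pend1 H]]];
    by split=> //; exists d1, pend1.
- move=> pre u suf c1 s1 adjE gs1 fr1 [rv [d1 [pend1 [qinv st sc pr]]]] ru c1_ge.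
  set qs := dn ++ v :: pend1 in qinv st sc pr.
  have vu : e v u by rewrite -(mem_adj adjP) adjE mem_cat inE eqxx orbT.
  have [n_s1 _ _] := gs1; have [s4 s5 sh stl] := st.
  have ltu := ltn_ord u; have ltv := ltn_ord v.
  have vqs : v \in qs by rewrite mem_cat inE eqxx orbT.
  have size_qs : size qs <= n.
    by have := uniq_leq_size (q_uniq qinv) (fun x _ => mem_enum 'I_n x); rewrite size_enum_ord.
  have dlt w : d1 w <= n.
    case: (boolP (w \in qs)) => [wq|].
      exact: leq_trans (q_index qinv wq) (leq_trans (index_size _ _) size_qs).
    by rewrite (q_visited qinv) negbK => /eqP->.
  have du := dlt u; have dv := dlt v.
  apply: wp_if => /=; rewrite ?ru ?rv ?s4 ?n_s1; try lia.
  case: (eqVneq (d1 u) n) => [dun|dun] /=.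
    have uqs : u \notin qs by rewrite (q_visited qinv) dun eqxx.
    have size_lt : size qs < n.
      have uq : uniq (u :: qs) by rewrite /= uqs (q_uniq qinv).
      by have := uniq_leq_size uq (fun x _ => mem_enum 'I_n x); rewrite size_enum_ord.
    apply: wp_seq; apply: wp_write => /=; rewrite ?ru ?rv ?s4; try lia.
    apply: wp_seq; apply: wp_write => /=; rewrite ?ru ?stl; try lia.
    apply: wp_assign => /=; rewrite ?stl; try lia.
    split; first by lia.
    split=> //=; pose d2 w := if w == u then (d1 v).+1 else d1 w.
    have uv : v != u by apply: contraNneq uqs => <-.
    have d2v : d2 v = d1 v by rewrite /d2 (negPf uv).
    exists d2, (rcons pend1 u); rewrite -rcons_cons -rcons_cat -/qs.
    have qinv2 : queue_inv d2 (rcons qs u) (rcons dn v) (d2 v).+1.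
      apply: (queue_inv_add _ vqs _ _ _ uqs) qinv => //.
      + by rewrite mem_rcons inE eqxx.
      + by rewrite e_sym.
      + by rewrite /d2 eqxx.
      + by move=> w wu; rewrite /d2 (negPf wu).
    split=> //.
    + split=> /=; rewrite ?size_rcons.
      * move=> w; rewrite /upd /= /d2 -val_eqE /=; case: eqP => // _; lia.
      * move=> i; rewrite ltnS nth_rcons /upd /= => il.
        case: (ltnP i (size qs)) => iq; first by rewrite ltn_eqF // s5.
        by rewrite (_ : i = size qs) ?eqxx //; lia.
      * by rewrite /upd /= sh size_rcons.
      * by rewrite /upd /= addn1.
    + move=> a b adn ab; have [bqs db] := sc a b adn ab.
      have aqs : a \in qs by rewrite mem_cat adn.
      rewrite mem_rcons inE bqs orbT; split=> //; rewrite /d2.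
      have -> : (b == u) = false by apply: contraNF uqs => /eqP<-.
      by have -> : (a == u) = false by apply: contraNF uqs => /eqP<-.
    + move=> w; rewrite !mem_rcons !inE d2v => /predU1P[->|wp].
        by rewrite eqxx /d2 eqxx.
      have [wqs dw] := pr w wp; rewrite wqs orbT; split=> //.
      by rewrite /d2; case: eqP.
  apply: wp_skip; first by lia.
  split; first by lia.
  split=> //; exists d1, pend1; split=> // w.
  rewrite mem_rcons inE => /predU1P[->|]; last exact: pr.
  have uqs : u \in qs by rewrite (q_visited qinv).
  by split=> //; apply: q_top qinv _ uqs.
- by split=> //; exists d, pend; split.
move=> c' s' c'_ge gs' fr' [rv [d1 [pend1 [qinv st sc pr]]]].
apply: (HQ c' s' d1 pend1) => //.
move=> a b; rewrite mem_rcons inE => /predU1P[-> vb|adn ab]; last exact: sc.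
by apply: pr; rewrite (mem_adj adjP).
Qed.

Lemma wp_bfs Q c s :
  let B := 60 + \sum_v (60 + 40 * size (adj v)) in
  graph_in adj s -> reg s rSrc = src -> B <= c ->
  (forall c' s', c <= c' + B -> graph_in adj s' -> frame bfs s s' ->
     is_level e src (fun v : 'I_n => arr s' 4 v) ->
     (forall v : 'I_n, arr s' 4 v < n) ->
     (forall v : 'I_n, arr s' 4 v <= reg s' rEcc) ->
     (exists v : 'I_n, arr s' 4 v = reg s' rEcc) ->
     Q c' s') ->
  wp W bfs Q c s.
Proof.
move=> B gs rs Bc HQ; apply: wp_frame.
have lts := ltn_ord src.
have BE : B = 60 + 20 * n + bfs_pot [::].
  rewrite /B /bfs_pot -addnA; congr (_ + _).
  have -> : 20 * n = \sum_(v < n) 20 by rewrite sum_nat_const card_ord mulnC.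
  by rewrite -big_split /=; apply: eq_bigr => v _; rewrite addnA.
clearbody B.
apply: wp_seq; apply: (wp_for_vertices W_large (f := fun=> 5)
  (I := fun i s1 => forall v : 'I_n, v < i -> arr s1 4 v = n)) => //.
- move=> v c1 s1 gs1 fr1 I1 riv c1_ge; have [n_s1 _ _] := gs1; have ltv := ltn_ord v.
  apply: wp_write => /=; rewrite ?riv ?n_s1; try lia.
  split; first by lia.
  by move=> w; rewrite ltnS leq_eqVlt /= /upd /=; case: eqP => //= _; apply: I1.
- by rewrite sum_nat_const card_ord; lia.
rewrite sum_nat_const card_ord => c1 s1 c1_ge gs1 fr1 I1.
have rs1 : reg s1 rSrc = src by case: fr1 => ->.
apply: wp_seq; apply: wp_write => /=; rewrite ?rs1; try lia.
apply: wp_seq; apply: wp_write => /=; rewrite ?rs1; try lia.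
apply: wp_seq; apply: wp_assign => //=; try lia.
apply: wp_seq; apply: wp_assign => //=; try lia.
set s2 := set_reg _ _ _; apply: wp_seq.
have gs2 : graph_in adj s2 by case: gs1 => ? ? ?; split.
set c2 := c1 - _ - _ - _ - _.
have c2_ge : c <= c2 + (50 + 20 * n) by rewrite /c2; lia.
clearbody c2; have n_gt0 : 0 < n by lia.
(* Between scans the bound [top] is only [n]; the condition on pending vertices, that no label in
   the queue exceeds theirs by more than one, restores it at the next dequeuing. *)
refine (@wp_while W _ _ (fun c3 s3 => graph_in adj s3 /\
  exists d dn pend, let qs := dn ++ pend in
  [/\ queue_inv d qs dn n, bfs_state d qs dn s3, scanned d qs dn,
      (forall u v, u \in pend -> v \in qs -> d v <= (d u).+1) /\
      (dn != [::] -> reg s3 rV = last src dn) &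
      c + bfs_pot dn <= c3 + (50 + 20 * n + bfs_pot [::])]) _ _ _ _ _); last first.
  split=> //; pose d v := if v == src then 0 else n.
  exists d, [::], [:: src] => /=.
  have dsrc : d src = 0 by rewrite /d eqxx.
  split=> //; last 2 first.
  - by split=> // u v; rewrite !inE => /eqP-> /eqP->; rewrite dsrc.
  - by lia.
  - split=> //=; rewrite ?inE //.
    + by move=> v; rewrite inE /d; case: (v == src); apply/esym/eqP; lia.
    + by move=> v; rewrite /d; case: eqP => // _; lia.
    + by move=> u v; rewrite !inE => /eqP-> /eqP->.
    + by move=> v; rewrite inE => /eqP->; rewrite dsrc.
    + by move=> v; rewrite inE => /eqP->; rewrite dsrc.
    + by move=> v; rewrite inE => /eqP->; rewrite dsrc.
  - split=> //=.
    + move=> v; rewrite /upd /= /d -val_eqE /=.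
      by case: eqP => // _; rewrite I1.
    + by case.
move=> c3 s3 fr3 [gs3 [d [dn [pend [qinv st sc [lo lastE] c3_ge]]]]].
set qs := dn ++ pend in qinv st sc lo.
have [n_s3 _ _] := gs3; have [s4 s5 sh stl] := st.
have size_qs : size qs <= n.
  by have := uniq_leq_size (q_uniq qinv) (fun x _ => mem_enum 'I_n x); rewrite size_enum_ord.
have size_qsE : size qs = size dn + size pend by rewrite size_cat.
rewrite /= sh stl size_qsE; split; try lia.
case: pend @qs size_qsE size_qs st stl s5 lo sc qinv c3_ge
  => [|v pend] qs size_qsE size_qs st stl s5 lo sc qinv c3_ge.
  rewrite addn0 ltnn /=.
  have qsE : qs = dn by rewrite /qs cats0.
  rewrite {}qsE {qs size_qsE} in size_qs st stl s5 lo sc qinv.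
  have [levP qall] := queue_inv_level e_sym conn qinv sc.
  have dn_n0 : dn != [::] by apply: contraTneq (qall src) => ->.
  have d_lt v : d v < n.
    by apply: leq_trans size_qs; apply: leq_ltn_trans (q_index qinv (qall v)) _; rewrite index_mem.
  have ltl := ltn_ord (last src dn); have dl := d_lt (last src dn).
  apply: wp_assign => /=; rewrite ?(lastE dn_n0) ?s4; try lia.
  move=> fr; apply: HQ => //=.
  - by lia.
  - case: levP => l0 lz ladj lpar; split=> [|v|u v|v]; rewrite ?s4 //.
    + exact: lz.
    + exact: ladj.
    + by move/lpar => [u vu du]; exists u; rewrite // s4.
  - by move=> v; rewrite s4.
  - by move=> v; rewrite /upd /= s4; apply: queue_inv_le_last qinv _ (qall v).
  - by exists (last src dn); rewrite /upd /= s4.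
rewrite -[X in X < _]addn0 ltn_add2l /=.
have vdn : v \notin dn.
  by have := q_uniq qinv; rewrite cat_uniq => /and3P[_ /norP[]].
have ltv := ltn_ord v; rewrite (bfs_potS vdn) in c3_ge.
have vE : arr s3 5 (size dn) = v.
  by rewrite s5 ?nth_cat ?ltnn ?subnn // size_cat /=; lia.
apply: wp_seq; apply: wp_assign => /=; rewrite ?sh ?vE; try nlia.
apply: wp_seq; apply: wp_assign => /=; rewrite /upd /= ?sh; try nlia.
set s5' := set_reg _ _ _.
have gs5 : graph_in adj s5' by case: gs3 => ? ? ?; split.
apply: (@wp_bfs_scan d dn v pend) => //; last 1 first.
- move=> c' s' d' pend' c'_ge gs' qs' qinv' st' sc' rv'.
  have size_qs' : size qs' <= n.
    by have := uniq_leq_size (q_uniq qinv') (fun x _ => mem_enum 'I_n x); rewrite size_enum_ord.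
  split=> //.
  exists d', (rcons dn v), pend'; rewrite cat_rcons -/qs'; split=> //.
  + case: qinv' => ? ? ? ? ? ? H7 ? ?; split=> // w wq.
    exact: leq_trans (H7 w wq) (leq_trans (index_size _ _) size_qs').
  + split; last by rewrite last_rcons.
    have vq' : v \in qs' by rewrite mem_cat inE eqxx orbT.
    move=> u w uq wq; have uq' : u \in qs' by rewrite mem_cat inE uq !orbT.
    apply: leq_trans (q_top qinv' wq) _; rewrite ltnS; apply: (q_sorted qinv') => //.
    have := q_uniq qinv'; rewrite cat_uniq => /and3P[_ H _].
    rewrite !index_cat (negPf vdn) /= eqxx addn0.
    case: ifP => udn; last exact: leq_addr.
    by move/hasPn/(_ u): H; rewrite inE uq orbT udn => /(_ isT).
  + by nlia.
- case: qinv => ? ? ? ? ? ? ? ? H9; split=> //.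
    by move=> w wq; apply: lo; rewrite ?inE ?eqxx.
  by move=> w wq w0; have [u [udn ? ?]] := H9 w wq w0; exists u; rewrite mem_rcons inE udn orbT.
- by case: st => ? ? ? ?; split=> //=; rewrite /upd /= ?size_rcons ?addn1.
- by nlia.
Qed.

End BreadthFirst.

(** * The first two searches and the choice of [y] *)

Notation rX := 10 (only parsing).
Notation rK := 11 (only parsing).
Notation rMin := 15 (only parsing).

(** Conjunction of two truth values, which are 0 or 1. *)
Definition both (x y : expr) : expr := Bin Lt (Const 1) (Bin Add x y).

(* Array 3 keeps the levels of the first search; array 6 the numbers of lower
   neighbours. *)
Definition sweep : cmd :=
  Seq (Assign rSrc (Reg rX))
  (Seq bfs
  (Seq (for_vertices (Write 3 (Reg rI) (Read 4 (Reg rI))))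
  (Seq (Assign rK (Reg rEcc))
  (Seq (Assign rBest (Reg rN))
  (Seq (argmin 6 (Bin Eq (Read 3 (Reg rI)) (Reg rK))
                 (Bin Eq (Bin Add (Read 3 (Reg rU)) (Const 1)) (Reg rK)))
  (Seq (Assign rMin (Reg rBest))
  (Seq (Assign rBest (Reg rN))
  (Seq (argmin 7 (both (Bin Eq (Read 3 (Reg rI)) (Reg rK))
                       (Bin Eq (Read 6 (Reg rI)) (Reg rMin)))
                 (both (Bin Eq (Read 3 (Reg rU)) (Reg rK))
                       (Bin Lt (Reg rMin) (Read 6 (Reg rU)))))
  (Seq (Assign rSrc (Reg rArg)) bfs))))))))).

Section Sweep.
Variables (n : nat) (e : rel 'I_n) (adj : 'I_n -> seq 'I_n) (W : nat).
Hypothesis adjP : adjacency_lists e adj.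
Hypothesis W_large : n + offset adj n + 10 <= W.
Hypotheses (e_sym : symmetric e) (e_irr : irreflexive e).
Hypothesis conn : forall u v, connect e u v.
Hypothesis no_isolated : no_isolated_vertex e.

Definition lev (a : nat) (s : state) (v : 'I_n) : nat := arr s a v.

(** The assumptions of the domination argument on [x], [y] and both searches, read off a machine
    state. *)
Record swept (x y : 'I_n) (k : nat) (s : state) : Prop := Swept {
  sw_x : reg s rX = x;
  sw_y : reg s rSrc = y;
  sw_k : reg s rK = k.+1;
  sw_L : is_level e x (lev 3 s);
  sw_L_lt : forall v, lev 3 s v < n;
  sw_L_le : forall v, lev 3 s v <= k.+1;
  sw_M : is_level e y (lev 4 s);
  sw_M_lt : forall v, lev 4 s v < n;
  sw_M_le : forall v, lev 4 s v <= reg s rEcc;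
  sw_M_max : exists v, lev 4 s v = reg s rEcc;
  sw_Ly : lev 3 s y = k.+1;
  sw_min : reg s rMin = #|lower_nbrs e (lev 3 s) k y|;
  sw_lower : forall v, lev 3 s v = k.+1 ->
    #|lower_nbrs e (lev 3 s) k y| <= #|lower_nbrs e (lev 3 s) k v|;
  sw_heavy : forall v, lev 3 s v = k.+1 ->
    #|lower_nbrs e (lev 3 s) k v| = #|lower_nbrs e (lev 3 s) k y| ->
    #|heavy_nbrs e y (lev 3 s) k y| <= #|heavy_nbrs e y (lev 3 s) k v|
}.

Lemma is_level_ext src l1 l2 : l1 =1 l2 -> is_level e src l1 -> is_level e src l2.
Proof.
move=> E [H1 H2 H3 H4]; split=> [|v|u v uv|v]; rewrite -!E //; first exact: H2.
  exact: H3.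
by move/H4 => [u vu uE]; exists u; rewrite -?E.
Qed.

(** A vertex is not its own neighbour. Hence [n] serves as an infinite initial count. *)
Lemma card_nbrs_lt (P : pred 'I_n) v : #|[set u | e v u && P u]| < n.
Proof.
suff : #|[set u | e v u && P u]| < #|'I_n| by rewrite card_ord.
rewrite -[X in _ < X]cardsT; apply: proper_card.
by apply/properP; split; [apply: subsetT|exists v; rewrite ?inE ?e_irr].
Qed.

Lemma sum_degrees a b : \sum_(v < n) (a + b * size (adj v)) = a * n + b * offset adj n.
Proof. by rewrite big_split /= sum_nat_const card_ord mulnC -big_distrr -offset_total. Qed.

Lemma both_ok s x y (b1 b2 : bool) : fits W s x -> fits W s y ->
  value s x = b1 -> value s y = b2 ->
  fits W s (both x y) /\ (value s (both x y) != 0) = b1 && b2.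
Proof.
move=> /= fx fy -> ->; rewrite fx fy.
by case: b1; case: b2 => /=; split; rewrite //=; lia.
Qed.

Lemma wp_sweep (x : 'I_n) Q c s :
  let B := 300 + 400 * n + 200 * offset adj n in
  graph_in adj s -> reg s rX = x -> B <= c ->
  (forall c' s' y k, c <= c' + B -> graph_in adj s' -> frame sweep s s' ->
     swept x y k s' -> Q c' s') ->
  wp W sweep Q c s.
Proof.
move=> B gs xE Bc HQ; apply: wp_frame; have ltx := ltn_ord x; rewrite {}/B in Bc HQ.
apply: wp_seq; apply: wp_assign => /=; rewrite ?xE; try lia.
apply: wp_seq; apply: (wp_bfs (src := x) adjP W_large e_sym conn) => //;
  rewrite ?sum_degrees; first by lia.
move=> c1 s1 c1_ge gs1 fr1 L1 L1lt L1le [w1 L1w].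
have [n_s1 _ _] := gs1; have k_lt : reg s1 rEcc < n by rewrite -L1w.
have x_s1 : reg s1 rX = x by case: fr1 => ->.
apply: wp_seq; apply: (wp_for_vertices W_large (f := fun=> 6)
  (I := fun i s2 => forall v : 'I_n, v < i -> arr s2 3 v = arr s1 4 v)) => //.
- move=> v c2 s2 gs2 fr2 I2 ri c2_ge; have ltv := ltn_ord v.
  have E4 : arr s2 4 v = arr s1 4 v by case: fr2 => _ ->.
  have L1v := L1lt v.
  apply: wp_write => /=; rewrite ?ri ?E4; try lia.
  split; first by lia.
  move=> u; rewrite ltnS leq_eqVlt /= /upd /=; case: eqP => [uv _|_]; last exact: I2.
  by rewrite (val_inj uv : u = v).
- by rewrite sum_nat_const card_ord; lia.
rewrite sum_nat_const card_ord => c2 s2 c2_ge gs2 fr2 I2.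
have [n_s2 _ _] := gs2.
have ecc2 : reg s2 rEcc = reg s1 rEcc by case: fr2 => ->.
have {}I2 (v : 'I_n) : arr s2 3 v = arr s1 4 v by apply: I2; apply: ltn_ord.
pose L (v : 'I_n) := arr s1 4 v; rewrite -/L in L1.
(* A neighbour of [x] shows that the eccentricity is positive. *)
have [k kE] : exists k, reg s1 rEcc = k.+1.
  have [v xv] := no_isolated x; have := L1le v.
  have : L v == 1 by rewrite (level1 e_sym e_irr L1).
  by rewrite /L => /eqP->; case: (reg s1 rEcc) => // k _; exists k.
rewrite kE in ecc2 k_lt L1w.
apply: wp_seq; apply: wp_assign => /=; rewrite ?ecc2; try lia.
apply: wp_seq; apply: wp_assign => /=; rewrite /upd /= ?n_s2; try lia.
set s3 := set_reg _ _ _.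
have gs3 : graph_in adj s3 by case: gs2 => ? ? ?; split.
have L3 (v : 'I_n) : arr s3 3 v = L v by apply: I2.
have k3 : reg s3 rK = k.+1 by [].
apply: wp_seq; apply: (wp_argmin adjP W_large (F := fun v => L v == k.+1)
  (P := fun _ u => L u == k)) => //=.
- by rewrite /upd /=; lia.
- move=> s4 v [fr_r fr_a] ri; have ltv := ltn_ord v; have Lv := L1lt v.
  rewrite fr_a // (fr_r rK) // ri L3 k3.
  by split; rewrite ?eqb0 ?negbK // /L; lia.
- move=> s4 v u [fr_r fr_a] ri ru; have ltu := ltn_ord u; have Lu := L1lt u.
  rewrite fr_a // (fr_r rK) // ru L3 k3.
  by split; rewrite ?eqb0 ?negbK ?addn1 ?eqSS // /L; lia.
- by rewrite sum_degrees; lia.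
rewrite sum_degrees => c4 s4 c4_ge gs4 fr4 cnt4 _ min4 sel4.
(* The initial [n] does not survive: [w1] is on the last level and its count is smaller. *)
have [v0 [Lv0 min_v0]] : exists v0, L v0 = k.+1 /\ reg s4 rBest = #|lower_nbrs e L k v0|.
  case: sel4 => [[bE _]|[v0 [/eqP Lv0 _ bE _]]]; last by exists v0.
  have := min4 w1; rewrite {1}/L L1w eqxx bE => /(_ isT).
  by rewrite /upd /= leqNgt card_nbrs_lt.
have cmin_lt : reg s4 rBest < n by rewrite min_v0; apply: card_nbrs_lt.
have [n_s4 _ _] := gs4.
apply: wp_seq; apply: wp_assign => /=; try lia.
apply: wp_seq; apply: wp_assign => /=; rewrite /upd /= ?n_s4; try lia.
set s5 := set_reg _ _ _.
have gs5 : graph_in adj s5 by case: gs4 => ? ? ?; split.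
have L5 (v : 'I_n) : arr s5 3 v = L v by rewrite /= -L3; case: fr4 => _ ->.
have k5 : reg s5 rK = k.+1 by rewrite /s5 /= /upd /=; case: fr4 => ->.
have min5 : reg s5 rMin = reg s4 rBest by [].
have cnt5 (v : 'I_n) : arr s5 6 v = #|lower_nbrs e L k v| by rewrite /= cnt4.
have lt_cnt (v : 'I_n) : arr s5 6 v < n by rewrite cnt5; apply: card_nbrs_lt.
pose F v := (L v == k.+1) && (#|lower_nbrs e L k v| == reg s4 rBest).
apply: wp_seq; apply: (wp_argmin adjP W_large
  (F := F)
  (P := fun _ u => (L u == k.+1) && (reg s4 rBest < #|lower_nbrs e L k u|))) => //=.
- by rewrite /upd /=; lia.
- move=> s6 v [fr_r fr_a] ri; have ltv := ltn_ord v; have Lv := L1lt v.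
  have cv := lt_cnt v; rewrite -/(L v) in Lv.
  have [|||| ff vv] := @both_ok s6 (Bin Eq (Read 3 (Reg rI)) (Reg rK))
    (Bin Eq (Read 6 (Reg rI)) (Reg rMin)) (L v == k.+1)
    (#|lower_nbrs e L k v| == reg s4 rBest).
  + by rewrite /= (fr_r rK) // fr_a // ri L5 k5; lia.
  + by rewrite /= (fr_r rMin) // fr_a // ri min5; lia.
  + by rewrite /= (fr_r rK) // fr_a // ri L5 k5.
  + by rewrite /= (fr_r rMin) // fr_a // ri min5 cnt5.
  by split.
- move=> s6 v u [fr_r fr_a] ri ru; have ltu := ltn_ord u; have Lu := L1lt u.
  have cu := lt_cnt u; rewrite -/(L u) in Lu.
  have [|||| ff vv] := @both_ok s6 (Bin Eq (Read 3 (Reg rU)) (Reg rK))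
    (Bin Lt (Reg rMin) (Read 6 (Reg rU))) (L u == k.+1)
    (reg s4 rBest < #|lower_nbrs e L k u|).
  + by rewrite /= (fr_r rK) // fr_a // ru L5 k5; lia.
  + by rewrite /= (fr_r rMin) // fr_a // ru min5; lia.
  + by rewrite /= (fr_r rK) // fr_a // ru L5 k5.
  + by rewrite /= (fr_r rMin) // fr_a // ru min5 cnt5.
  by split.
- by rewrite sum_degrees; lia.
rewrite sum_degrees => c6 s6 c6_ge gs6 fr6 cnt6 _ min6 sel6.
have Fv0 : F v0 by rewrite /F Lv0 min_v0 !eqxx.
(* Likewise [n] does not survive the second scan, since [v0] passes its filter. *)
have [y [Ly yE cy min_y]] : exists y, [/\ L y = k.+1, reg s6 rArg = y,
    reg s4 rBest = #|lower_nbrs e L k y| &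
    forall v, L v = k.+1 -> #|lower_nbrs e L k v| = #|lower_nbrs e L k y| ->
      #|heavy_nbrs e y L k y| <= #|heavy_nbrs e y L k v|].
  case: sel6 => [[bE _]|[y [/andP[/eqP Ly /eqP cy] yE bE _]]].
    have := min6 v0 Fv0; rewrite bE /upd /= leqNgt.
    by rewrite (card_nbrs_lt (fun u => (L u == k.+1) && (reg s4 rBest < #|lower_nbrs e L k u|))).
  exists y; split=> // v Lv cv.
  have := min6 v; rewrite /F Lv eqxx cv cy eqxx bE => /(_ isT).
  by rewrite /heavy_nbrs -/(lower_nbrs e L k y) cy.
have n_s6 : reg s6 rN = n by case: gs6.
have lty := ltn_ord y.
apply: wp_seq; apply: wp_assign => /=; rewrite ?yE; try lia.
set s7 := set_reg _ _ _; apply: wp_frame.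
have gs7 : graph_in adj s7 by case: gs6 => ? ? ?; split.
apply: (wp_bfs (src := y) adjP W_large e_sym conn) => //; rewrite ?sum_degrees; first by lia.
move=> c8 s8 c8_ge gs8 fr8 M8 M8lt M8le M8max _ fr.
have [r8 a8] := fr8; have [r6 a6] := fr6; have [r4 a4] := fr4.
have L8 (v : 'I_n) : lev 3 s8 v = L v by rewrite /lev a8 //= a6 // L5.
have L8s := fun v => esym (L8 v).
apply: (HQ _ _ y k) => //; first by lia.
have lower8 v : lower_nbrs e (lev 3 s8) k v = lower_nbrs e L k v.
  by apply/setP => u; rewrite !inE L8.
have heavy8 v : heavy_nbrs e y (lev 3 s8) k v = heavy_nbrs e y L k v.
  by apply/setP => u; rewrite !inE !lower8 L8.
split=> //.
- by rewrite r8 //= /upd /= r6 //= /upd /= r4 //= /upd /=; case: fr2 => ->.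
- by rewrite r8.
- by rewrite r8 //= /upd /= r6.
- exact: is_level_ext L8s L1.
- by move=> v; rewrite L8; apply: L1lt.
- by move=> v; rewrite L8 /L -kE; apply: L1le.
- by rewrite L8.
- by rewrite lower8 -cy r8 //= /upd /= r6.
- move=> v; rewrite L8 !lower8 -cy => Lv.
  by have := min4 v; rewrite Lv eqxx => /(_ isT).
- by move=> v; rewrite L8 !lower8 !heavy8; apply: min_y.
Qed.

(** * Choosing the end [z] and collecting the path *)

Notation rP := 16 (only parsing).
Notation rPrev := 17 (only parsing).
Notation rLev := 18 (only parsing).
Notation rPar := 19 (only parsing).

Definition two_sweeps : cmd :=
  Seq sweep
      (If (both (Bin Lt (Reg rK) (Const 3)) (Bin Lt (Const 2) (Reg rEcc)))
          (Seq (Assign rX (Reg rSrc)) sweep) Skip).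

(** For eccentricity at most 2, [x] is preset with the count of [y], so another end is taken only if
    strictly better; otherwise [n] acts as infinity. *)
Definition select_end : cmd :=
  Seq (If (Bin Lt (Reg rK) (Const 3))
          (Seq (Assign rBest (Reg rMin)) (Assign rArg (Reg rX)))
          (Assign rBest (Reg rN)))
      (argmin 7 (Bin Eq (Read 4 (Reg rI)) (Reg rEcc))
                (Bin Eq (Bin Add (Read 4 (Reg rU)) (Const 1)) (Reg rEcc))).

(** [rPar] toggles with the number of chosen vertices, and [rPrev] keeps the vertex before the
    current one, finally the path neighbour of [y]. *)
Definition climb : cmd :=
  While (Reg rLev)
    (Seq (best_nbr rP (Bin Eq (Bin Add (Read 4 (Reg rU)) (Const 1)) (Reg rLev))
                      (Read 3 (Reg rU)))
    (Seq (Assign rPrev (Reg rP))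
    (Seq (Assign rP (Reg rArg))
    (Seq (Write 2 (Reg rP) (Const 1))
    (Seq (Assign rLev (Bin Defs.Sub (Reg rLev) (Const 1)))
         (Assign rPar (Bin Defs.Sub (Const 1) (Reg rPar)))))))).

(** Comparing with 0 negates the inner test, so the path neighbour of [y] is skipped; if no other
    neighbour is found, [y] is deleted. *)
Definition even_out : cmd :=
  If (Reg rPar)
     (Seq (best_nbr rP (Bin Eq (Const 0) (Bin Eq (Reg rU) (Reg rPrev))) (Read 3 (Reg rU)))
          (If (Bin Lt (Reg rBest) (Reg rN))
              (Write 2 (Reg rArg) (Const 1)) (Write 2 (Reg rP) (Const 0))))
     Skip.

Definition collect : cmd :=
  Seq (Assign rP (Reg rArg))
  (Seq (Write 2 (Reg rP) (Const 1))
  (Seq (Assign rLev (Read 4 (Reg rP)))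
  (Seq (Assign rPar (Const 1))
  (Seq climb even_out)))).

Lemma level_unique src l1 l2 : is_level e src l1 -> is_level e src l2 -> l1 =1 l2.
Proof.
suff le l l' : is_level e src l -> is_level e src l' -> forall v, l v <= l' v.
  by move=> P1 P2 v; apply/eqP; rewrite eqn_leq !le.
move=> P1 P2 v; elim: {v}(l' v) {-2}v (erefl (l' v)) => [|i IH] v lv.
  by case: P2 => _ H _ _; rewrite (H v lv) (level_src P1).
have [|u vu lu] := @level_parent _ _ _ _ P2 v; first by rewrite lv.
have [H _] := level_adj e_sym P1 vu; have := IH u ltac:(lia); lia.
Qed.

Lemma wp_two_sweeps (x : 'I_n) Q c s :
  let B := 700 + 800 * n + 400 * offset adj n in
  graph_in adj s -> reg s rX = x -> B <= c ->
  (forall c' s' x y k, c <= c' + B -> graph_in adj s' -> frame two_sweeps s s' ->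
     swept x y k s' -> 2 <= k \/ reg s' rEcc <= 2 -> Q c' s') ->
  wp W two_sweeps Q c s.
Proof.
move=> B gs xE Bc HQ; apply: wp_frame; have ltx := ltn_ord x; rewrite {}/B in Bc HQ.
apply: wp_seq; apply: (wp_sweep gs xE); first by lia.
move=> c1 s1 y1 k1 c1_ge gs1 _ sw1.
have ecc_lt : reg s1 rEcc < n by have [v <-] := sw_M_max sw1; apply: sw_M_lt sw1 v.
have k_lt : k1.+1 < n by rewrite -(sw_Ly sw1); apply: sw_L_lt sw1 y1.
have lty := ltn_ord y1.
have [|||| fb vb] := @both_ok s1 (Bin Lt (Reg rK) (Const 3)) (Bin Lt (Const 2) (Reg rEcc))
  (k1.+1 < 3) (2 < reg s1 rEcc).
- by rewrite /= (sw_k sw1); lia.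
- by rewrite /=; lia.
- by rewrite /= (sw_k sw1).
- by [].
apply: wp_if => //=; first by lia.
rewrite vb; case: ifP => [/andP[k1_lt ecc_gt]|H]; last first.
  apply: wp_skip; first by lia.
  move=> fr; apply: (HQ _ _ x y1 k1) => //; first by lia.
  by move/negbT: H; rewrite negb_and -!leqNgt => /orP[H|H]; [left|right].
apply: wp_seq; apply: wp_assign => /=; rewrite ?(sw_y sw1); try lia.
set s2 := set_reg _ _ _.
have gs2 : graph_in adj s2 by case: gs1 => ? ? ?; split.
apply: (@wp_sweep y1) => //; first by lia.
move=> c3 s3 y3 k3 c3_ge gs3 _ sw3 fr.
apply: (HQ _ _ y1 y3 k3) => //; first by lia.
(* The second sweep is rooted at [y1], and levels from [y1] are unique, so the eccentricity above 2
   found by the first sweep is a lower bound for [k3.+1]. *)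
left; have [v vE] := sw_M_max sw1.
have := sw_L_le sw3 v; rewrite (level_unique (sw_L sw3) (sw_M sw1)) vE; lia.
Qed.

Lemma wp_select_end (x y : 'I_n) k Q c s :
  let B := 100 + 100 * n + 50 * offset adj n in
  graph_in adj s -> swept x y k s -> 2 <= k \/ reg s rEcc <= 2 -> B <= c ->
  (forall c' s' z, c <= c' + B -> graph_in adj s' -> frame select_end s s' ->
     reg s' rArg = val z ->
     good_end e x y (lev 3 s) (lev 4 s) k (reg s rEcc) z -> Q c' s') ->
  wp W select_end Q c s.
Proof.
move=> B gs sw km Bc HQ; apply: wp_frame; rewrite {}/B in Bc HQ.
set L := lev 3 s in HQ *; set M := lev 4 s in HQ *; set m := reg s rEcc in km HQ *.
have ecc_lt : m < n by have [v vE] := sw_M_max sw; rewrite /m -vE; apply: sw_M_lt sw v.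
have k_lt : k.+1 < n by rewrite -(sw_Ly sw); apply: sw_L_lt sw y.
have ltx := ltn_ord x; have [n_s _ _] := gs.
have cmin_lt : reg s rMin < n by rewrite (sw_min sw); apply: card_nbrs_lt.
(* [x] and [y] differ, being on different levels of [L], so [m] is positive. *)
have [m' mE] : exists m', m = m'.+1.
  have := sw_M_le sw x; rewrite -/m; case: (m) => [|m' _]; last by exists m'.
  rewrite leqn0 => /eqP Mx.
  have [_ H _ _] := sw_M sw; have := sw_Ly sw.
  by rewrite -(H x Mx) (level_src (sw_L sw)).
apply: wp_seq.
pose Init c1 s1 := [/\ c <= c1 + 30, graph_in adj s1,
  forall a, arr s1 a = arr s a, reg s1 rEcc = m &
  (k < 2 /\ reg s1 rBest = reg s rMin /\ reg s1 rArg = x) \/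
  (2 <= k /\ reg s1 rBest = n)].
apply: (@wp_mono W _ Init) => [c1 s1 [c1_ge gs1 arr1 ecc1 init]|]; last first.
  apply: wp_if => /=; rewrite ?(sw_k sw); try lia.
  case: (ltnP k.+1 3) => k3 /=.
    apply: wp_seq; apply: wp_assign => /=; try lia.
    apply: wp_assign => /=; rewrite /upd /= ?(sw_x sw); try lia.
    split=> //=; first by lia.
    by left.
  apply: wp_assign => /=; rewrite ?n_s; try lia.
  split=> //=; first by lia.
  by right.
have best_le : reg s1 rBest <= n by case: init => [[_ [-> _]]|[_ ->]]; lia.
have M1 (v : 'I_n) : arr s1 4 v = M v by rewrite arr1.
have M_lt v : M v < n by apply: sw_M_lt sw v.
apply: (wp_argmin adjP W_large (F := fun v => M v == m) (P := fun _ u => M u == m')) => //=.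
- by lia.
- move=> s2 v [fr_r fr_a] ri; have ltv := ltn_ord v; have Mv := M_lt v.
  rewrite /= fr_a // (fr_r rEcc) // ri M1 ecc1.
  by split; rewrite ?eqb0 ?negbK //; lia.
- move=> s2 v u [fr_r fr_a] ri ru; have ltu := ltn_ord u; have Mu := M_lt u.
  rewrite /= fr_a // (fr_r rEcc) // ru M1 ecc1.
  by split; rewrite ?eqb0 ?negbK ?addn1 ?mE ?eqSS //; lia.
- by rewrite sum_degrees; lia.
rewrite sum_degrees => c2 s2 c2_ge gs2 fr2 _ _ min2 sel2 fr.
have good z : M z = m -> (k < 2 -> #|nbrs_at e M m' z| < #|lower_nbrs e L k y|) ->
    (forall w, M w = m -> #|nbrs_at e M m' z| <= #|nbrs_at e M m' w|) ->
    good_end e x y L M k m z.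
  move=> Mz zlt zmin; rewrite /good_end mE /= -mE.
  case: (ltnP k 2) => k2; last by left.
  right; split=> //; first by case: km => //; lia.
  by right; split=> //; apply: zlt.
case: sel2 => [[bE aE]|[z [/eqP Mz zE bE zlt]]]; last first.
  apply: (HQ _ _ z) => //; first by lia.
  apply: good => // [k2|w /eqP Mw].
    case: init => [[_ [bI _]]|[]]; last by lia.
    by rewrite /nbrs_at /L -(sw_min sw) -bI.
  by have := min2 w Mw; rewrite bE.
case: init => [[k2 [bI aI]]|[k2 bI]].
  apply: (HQ _ _ x) => //; first by lia.
    by rewrite aE aI.
  right; split=> //; first by case: km => //; lia.
  left; split=> // w /eqP Mw; have := min2 w Mw.
  by rewrite bE bI (sw_min sw) mE.
(* With [n] as start value some vertex of level [m] must have been chosen, as every count is below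
   [n]. *)
have [w wE] := sw_M_max sw; have := min2 w; rewrite -/(M w) in wE; rewrite wE eqxx.
move/(_ isT); rewrite bE bI leqNgt.
by rewrite (card_nbrs_lt (fun u => M u == m')).
Qed.

Definition climb_inv (L M : 'I_n -> nat) (z p : 'I_n) rest (s : state) : Prop :=
  [/\ [/\ reg s rP = p, reg s rLev = M p & reg s rPar = odd (size (p :: rest))],
      forall v : 'I_n, arr s 2 v = (v \in p :: rest),
      path (descends e L M) p rest, last p rest = z &
      rest != [::] -> reg s rPrev = head p rest].

Section Collect.
Variables (L M : 'I_n -> nat) (y : 'I_n).
Hypotheses (MP : is_level e y M).
Hypotheses (L_lt : forall v, L v < n) (M_lt : forall v, M v < n).

(** The path meets each level once, so the scans along it are paid for by distinct vertices and the
    total is linear. *)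
Definition climb_pot (l : nat) : nat := \sum_(v | M v <= l) (50 + 90 * size (adj v)).

Lemma climb_potS v : 0 < M v ->
  climb_pot (M v).-1 + (50 + 90 * size (adj v)) <= climb_pot (M v).
Proof.
move=> Mv; rewrite /climb_pot (bigD1 (P := fun u => M u <= M v) v) //= addnC leq_add2l.
rewrite [X in X <= _]big_mkcond [X in _ <= X]big_mkcond; apply: leq_sum => u _.
case: ifP => // Mu; rewrite ifT //; apply/andP; split; first by lia.
by apply: contraTneq Mu => ->; rewrite -ltnNge; lia.
Qed.

Lemma wp_climb z Q c s :
  let B := 10 + 50 * n + 90 * offset adj n in
  graph_in adj s -> (forall v : 'I_n, arr s 3 v = L v) ->
  (forall v : 'I_n, arr s 4 v = M v) -> climb_inv L M z z [::] s -> B <= c ->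
  (forall c' s' rest, c <= c' + B -> graph_in adj s' -> frame climb s s' ->
     climb_inv L M z y rest s' -> Q c' s') ->
  wp W climb Q c s.
Proof.
move=> B gs L_s M_s inv0 Bc HQ; apply: wp_frame; rewrite {}/B in Bc HQ.
have pot_z : climb_pot (M z) <= 50 * n + 90 * offset adj n.
  rewrite -sum_degrees /climb_pot big_mkcond /=; apply: leq_sum => v _.
  by case: ifP.
refine (@wp_while W _ _ (fun c1 s1 => graph_in adj s1 /\
  exists p rest, climb_inv L M z p rest s1 /\
    c + climb_pot (M p) <= c1 + 50 * n + 90 * offset adj n) _ _ _ _ _); last first.
  by split=> //; exists z, [::]; split=> //; lia.
move=> c1 s1 fr [gs1 [p [rest [[[rp rl rpar] out pth lst prev] c1_ge]]]].
have Mp := M_lt p; have [fr_r fr_a] := fr.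
rewrite /= rl; split; try lia.
case: eqP => [M0|/eqP]; last rewrite -lt0n => Mp_gt0.
  have py : p = y by case: MP => _ H _ _; apply: H.
  move=> frc; apply: (HQ _ _ rest) => //; first by lia.
  by rewrite -py.
have potS := climb_potS Mp_gt0; have ltp := ltn_ord p.
have L1 (v : 'I_n) : arr s1 3 v = L v by rewrite fr_a.
have M1 (v : 'I_n) : arr s1 4 v = M v by rewrite fr_a.
apply: wp_seq; apply: (wp_best_nbr adjP W_large (v := p)
  (F := fun u => (M u).+1 == M p) (k := L)) => //=.
- move=> s2 u [r2 a2] ru; have ltu := ltn_ord u; have Mu := M_lt u.
  rewrite a2 // (r2 rLev) // ru M1 rl.
  by split; rewrite ?eqb0 ?negbK ?addn1 //; lia.
- move=> s2 u [r2 a2] ru; have ltu := ltn_ord u; have Lu := L_lt u.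
  by rewrite a2 // ru L1; split=> //; lia.
- by lia.
move=> c2 s2 c2_ge gs2 fr2 min2 sel2.
have [q [pq /eqP Mq qE bE]] : exists u, [/\ e p u, (M u).+1 == M p, reg s2 rArg = u &
    reg s2 rBest = L u].
  case: sel2 => [bE|[u [pu Mu uE bE _]]]; last by exists u.
  have [u pu Mu] := level_parent MP Mp_gt0.
  by have := min2 u pu; rewrite Mu eqxx bE => /(_ isT); have := L_lt u; lia.
have [r2 a2] := fr2.
have rp2 : reg s2 rP = p by rewrite r2.
have rl2 : reg s2 rLev = M p by rewrite r2.
have rpar2 : reg s2 rPar = odd (size (p :: rest)) by rewrite r2.
have out2 (v : 'I_n) : arr s2 2 v = (v \in p :: rest) by rewrite a2.
have ltq := ltn_ord q.
apply: wp_seq; apply: wp_assign => /=; rewrite ?rp2; try lia.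
apply: wp_seq; apply: wp_assign => /=; rewrite /upd /= ?qE; try lia.
apply: wp_seq; apply: wp_write => /=; rewrite /upd /=; try lia.
apply: wp_seq; apply: wp_assign => /=; rewrite /upd /= ?rl2; try lia.
have par_lt : reg s2 rPar <= 1 by rewrite rpar2; case: odd.
apply: wp_assign => /=; rewrite /upd /= ?rpar2; try lia.
split; first by case: gs2 => ? ? ?; split.
have predE : (M p).-1 = M q by rewrite -Mq.
exists q, (p :: rest); split; last by rewrite predE in potS; lia.
split=> //=.
- split=> //; first by rewrite /upd /= subn1 -Mq.
  by rewrite /upd /=; case: odd.
- by move=> v; rewrite in_cons -val_eqE /= /upd /= out2; case: eqP.
rewrite pth andbT /descends pq Mq eqxx /=.
apply/forallP => u; apply/implyP => pu; apply/implyP => /eqP Mu.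
by rewrite -bE; apply: min2 => //; rewrite Mu Mq.
Qed.

Lemma wp_even_out z rest Q c s :
  let B := 100 + 90 * offset adj n in
  let p1 := nth y (y :: rest) 1 in
  graph_in adj s -> (forall v : 'I_n, arr s 3 v = L v) ->
  climb_inv L M z y rest s -> rest != [::] -> uniq (y :: rest) -> B <= c ->
  (forall c' s', c <= c' + B ->
     [\/ ~~ odd (size (y :: rest)) /\ output n s' = [set u in y :: rest],
         exists q, [/\ odd (size (y :: rest)), e y q, q != p1,
           forall u, e y u -> u != p1 -> L q <= L u &
           output n s' = [set u in q :: y :: rest]] |
         [/\ odd (size (y :: rest)), forall u, e y u -> u = p1 &
           output n s' = [set u in rest]]] -> Q c' s') ->
  wp W even_out Q c s.
Proof.
move=> B p1 gs L_s [[rp rl rpar] out pth lst prev] rest0 uq Bc HQ; rewrite {}/B in Bc HQ.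
have n_s : reg s rN = n by case: gs.
have lty := ltn_ord y; have deg := size_adj_le adj y.
have prevE : reg s rPrev = p1 by rewrite prev // /p1; case: (rest) rest0.
have ltp1 := ltn_ord p1.
set par := odd _ in rpar HQ; have par1 : par <= 1 by case: (par).
clearbody par.
apply: wp_if => /=; rewrite ?rpar; try lia.
case: (boolP par) => s_odd /=; last first.
  apply: wp_skip; first by lia.
  apply: HQ; first by lia.
  by apply: Or31; split=> //; apply/setP => v; rewrite !inE out inE eqb0 negbK.
apply: wp_seq; apply: (wp_best_nbr adjP W_large (v := y)
  (F := fun u => u != p1) (k := L)) => //=.
- move=> s2 u [r2 a2] ru; have ltu := ltn_ord u.
  rewrite (r2 rPrev) // ru prevE val_eqE.
  by case: (u == p1); split=> //=; lia.
- move=> s2 u [r2 a2] ru; have ltu := ltn_ord u; have Lu := L_lt u.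
  by rewrite a2 // ru L_s; split=> //; lia.
- by lia.
move=> c2 s2 c2_ge gs2 fr2 min2 sel2; have [r2 a2] := fr2.
have n_s2 : reg s2 rN = n by case: gs2.
have out2 (v : 'I_n) : arr s2 2 v = (v \in y :: rest) by rewrite a2.
have rp2 : reg s2 rP = y by rewrite r2.
have best_le : reg s2 rBest <= n by case: sel2 => [->//|[u [_ _ _ ->]]]; apply: ltnW.
apply: wp_if => /=; rewrite ?n_s2; try lia.
case: sel2 => [bE|[q [yq q1 qE bE Lq]]].
  rewrite bE ltnn /=; apply: wp_write => /=; rewrite ?rp2; try lia.
  apply: HQ; first by lia.
  apply: Or33; split=> //.
    move=> u yu; apply/eqP; apply: contraT => u1.
    by have := min2 u yu u1; have := L_lt u; rewrite bE; lia.
  apply/setP => v; rewrite !inE /= /upd /=; have /andP[y_rest _] := uq.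
  rewrite (_ : (nat_of_ord v == y) = (v == y)) //.
  case: (eqVneq v y) => [->|vy]; first by rewrite (negPf y_rest).
  by rewrite out2 inE (negPf vy) eqb0 negbK.
have ltq := ltn_ord q.
rewrite bE Lq /=; apply: wp_write => /=; rewrite ?qE; try lia.
apply: HQ; first by lia.
apply: Or32; exists q; split=> //; first by move=> u yu u1; rewrite -bE; apply: min2.
apply/setP => v; rewrite !inE /= /upd /= (_ : (nat_of_ord v == q) = (v == q)) //.
case: (eqVneq v q) => //= _.
by rewrite out2 inE eqb0 negbK.
Qed.

End Collect.

(** * The complete algorithm *)

Definition paired_dominating : cmd :=
  Seq two_sweeps (Seq select_end collect).

Hypothesis atf : at_free e.

Lemma wp_collect (x y z : 'I_n) (L M : 'I_n -> nat) k m Q c s :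
  let B := 200 + 50 * n + 180 * offset adj n in
  graph_in adj s -> is_level e x L -> is_level e y M ->
  (forall v, L v <= k.+1) -> (forall v, M v <= m) -> L y = k.+1 ->
  (forall v, L v < n) -> (forall v, M v < n) ->
  (forall v, L v = k.+1 -> #|lower_nbrs e L k y| <= #|lower_nbrs e L k v|) ->
  (forall v, L v = k.+1 -> #|lower_nbrs e L k v| = #|lower_nbrs e L k y| ->
     #|heavy_nbrs e y L k y| <= #|heavy_nbrs e y L k v|) ->
  good_end e x y L M k m z ->
  (forall v : 'I_n, arr s 3 v = L v) -> (forall v : 'I_n, arr s 4 v = M v) ->
  (forall v : 'I_n, arr s 2 v = 0) -> reg s rArg = z -> B <= c ->
  (forall c' s', c <= c' + B -> good_pd_set e (output n s') -> Q c' s') ->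
  wp W collect Q c s.
Proof.
move=> B gs LP MP L_le M_le Ly L_lt M_lt lower heavy zgood L_s M_s out zE Bc HQ.
rewrite {}/B in Bc HQ; have ltz := ltn_ord z; have Mz := M_lt z.
apply: wp_seq; apply: wp_assign => /=; rewrite ?zE; try lia.
apply: wp_seq; apply: wp_write => /=; rewrite /upd /=; try lia.
apply: wp_seq; apply: wp_assign => /=; rewrite /upd /= ?M_s; try lia.
apply: wp_seq; apply: wp_assign => /=; try lia.
set s1 := set_reg _ _ _.
have gs1 : graph_in adj s1 by case: gs => ? ? ?; split.
apply: wp_seq; apply: (wp_climb MP L_lt M_lt (z := z)) => //.
- split=> //= v; rewrite /upd /= inE -val_eqE out; case: eqP => //.
- by lia.
move=> c2 s2 rest c2_ge gs2 [_ a2] inv; have [_ _ pth lst _] := inv.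
(* An end equal to [y] would contradict [0 < m] or [L y = k.+1]; hence the path has at least one
   edge. *)
have zy : z != y.
  apply/eqP => zy; move: zgood; rewrite zy /good_end (level_src MP).
  have : 0 < m.
    have := M_le x; case: (m) => // ; rewrite leqn0 => /eqP Mx.
    by case: MP => _ H _ _; move: Ly; rewrite -(H x Mx) (level_src LP).
  move=> m0 [[_ H _]|[_ _ [[H _]|[H _ _]]]]; try by move: m0; rewrite -H.
  by move: Ly; rewrite H (level_src LP).
have rest0 : rest != [::] by apply: contraNneq zy => rE; rewrite -lst rE.
rewrite -lst in zgood.
have uq := path_uniq MP pth.
apply: (wp_even_out L_lt _ _ inv) => //; try lia.
  by move=> v; rewrite a2 //; apply: L_s.
move=> c3 s3 c3_ge cases; apply: HQ; first by lia.
case: cases => [[ev ->]|[q [od yq q1 qmin ->]]|[od only ->]].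
- exact: (path_even_good e_sym e_irr atf LP MP L_le M_le Ly lower heavy rest0 pth).
- exact: (path_add_good e_sym e_irr atf LP MP L_le M_le Ly lower heavy rest0 pth).
- exact: (path_drop_good e_sym e_irr atf LP MP L_le M_le Ly lower heavy rest0 pth).
Qed.

Lemma wp_paired_dominating (x : 'I_n) :
  wp W paired_dominating (fun _ s => good_pd_set e (output n s))
     (2000 * n + 700 * offset adj n) (input adj).
Proof.
have n_gt0 : 0 < n := leq_ltn_trans (leq0n x) (ltn_ord x).
(* The registers other than [rN] start at 0, so vertex 0 is the first root. *)
apply: wp_seq; apply: (@wp_two_sweeps (Ordinal n_gt0)); first exact: graph_in_input.
- by [].
- by lia.
move=> c1 s1 x1 y k c1_ge gs1 [_ a1] sw km.
apply: wp_seq; apply: (wp_select_end gs1 sw km); first by lia.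
move=> c2 s2 z c2_ge gs2 [_ a2] zE zgood.
apply: (wp_collect gs2 (sw_L sw) (sw_M sw) (sw_L_le sw) (sw_M_le sw) (sw_Ly sw)
  (sw_L_lt sw) (sw_M_lt sw) (sw_lower sw) (sw_heavy sw) zgood) => //.
- by move=> v; rewrite a2.
- by move=> v; rewrite a2.
- by move=> v; rewrite a2 // a1 //= nth_nil.
- by lia.
Qed.

(** The total length of the lists is at most the number of ordered adjacent pairs. *)
Lemma offset_le_edges : offset adj n <= 2 * #|edges e|.
Proof.
apply: leq_trans (card_arcs e_irr); rewrite offset_total -sum1_card.
rewrite (eq_bigl (fun p : 'I_n * 'I_n => true && e p.1 p.2)) => [|p]; last by rewrite inE.
rewrite -(pair_big_dep xpredT (fun u v => e u v) (fun _ _ => 1)) /=.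
apply: leq_sum => v _; rewrite -(count_predT (adj v)) -(card_nbrs adjP) sum1_card.
by apply: subset_leq_card; apply/subsetP => u; rewrite inE andbT.
Qed.

End Sweep.

Theorem theorem2 :
  exists (p : cmd) (c k : nat),
  forall (n : nat) (e : rel 'I_n) (adj : 'I_n -> seq 'I_n),
    simple_graph e -> connected_graph e -> no_isolated_vertex e ->
    at_free e -> adjacency_lists e adj ->
    exists (t : nat) (s : state),
      [/\ exec ((n + #|edges e|) ^ k) p (input adj) t s,
          t <= c * (n + #|edges e|),
          pd_set e (output n s) &
          #|output n s| <= 2 * gamma_pr e].
Proof.
(* The time is at most [2000 * n + 700 * offset adj n], where the offset is at most twice the number
   [E] of edges. For the words, [n + E >= 3] gives [(n + E) ^ 3 >= 9 * (n + E)], which exceeds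
   [n + 2 * E + 10]. *)
exists paired_dominating, 2000, 3 => n e adj [e_sym e_irr] [n_gt0 conn] iso atf adjP.
rewrite card_ord in n_gt0; pose x := Ordinal n_gt0.
have off := offset_le_edges adjP e_irr; have [v xv] := iso x.
have n_gt1 : 1 < n.
  have := ltn_ord v; have : v != 0 :> nat.
    by apply: contraTneq xv => v0; rewrite (_ : v = x) ?e_irr //; apply: val_inj.
  lia.
have edges_gt0 : 0 < #|edges e|.
  by apply/card_gt0P; exists [set x; v]; apply/edgesP; exists x, v.
set E := #|edges e| in off edges_gt0 *.
have W_large : n + offset adj n + 10 <= (n + E) ^ 3.
  have : 9 * (n + E) <= (n + E) ^ 3.
    rewrite !expnS expn0 muln1 mulnA leq_mul2r; apply/orP; right.
    by apply: (@leq_mul 3 3); lia.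
  by lia.
have [t [s [exec_s t_le [pd card_pd]]]] :=
  wp_paired_dominating adjP W_large e_sym e_irr conn iso atf x.
by exists t, s; split=> //; lia.
Qed.
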